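(* Let $\mu,\nu\in P_2(\mathbb{R}^d)$. Then $$\mathcal{T}_2(\mathrm{P}^{cx}_{2,\mu\le},\nu)=\mathcal{D}_2(\mathrm{P}^{cx}_{2,\mu\le},\nu)=\mathcal{D}_2(\mu,\mathrm{P}^{cx}_{2,\le\nu})=\mathcal{T}_2(\mu,\mathrm{P}^{cx}_{2,\le\nu}).$$ Moreover: (i) if $\varphi^f\in\mathcal{A}_{cx}\cap C_{b,2}$ attains $\mathcal{D}_2(\mathrm{P}^{cx}_{2,\mu\le},\nu)$, then $Q_{\bar2}(\varphi^f)\in\mathcal{A}_{cx}\cap L^1(d\nu)$ and $\int Q_2(Q_{\bar2}(\varphi^f))\,d\mu-\int Q_{\bar2}(\varphi^f)\,d\nu=\mathcal{D}_2(\mu,\mathrm{P}^{cx}_{2,\le\nu})$; (ii) if $\varphi^b\in\mathcal{A}_{cx}\cap L^1(d\nu)$ attains $\mathcal{D}_2(\mu,\mathrm{P}^{cx}_{2,\le\nu})$, then $Q_2(\varphi^b)\in\mathcal{A}_{cx}\cap\mathrm{S}_{b,2}$ and $\int Q_2(\varphi^b)\,d\mu-\int Q_{\bar2}(Q_2(\varphi^b))\,d\nu=\mathcal{D}_2(\mathrm{P}^{cx}_{2,\mu\le},\nu)$.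
   Context: $\mu\le_{cx}\nu$: $\int\varphi\,d\mu\le\int\varphi\,d\nu$ for all real-valued convex $\varphi$ with both integrals existing in the extended sense. $\mathcal{A}_{cx}$: proper lsc convex functions $\mathbb{R}^d\to\mathbb{R}\cup\{+\infty\}$. $\mathrm{P}^{cx}_{2,\le\nu}=\{\eta\in P_2:\eta\le_{cx}\nu\}$, $\mathrm{P}^{cx}_{2,\mu\le}=\{\xi\in P_2:\mu\le_{cx}\xi\}$. $\mathcal{T}_2$ is the optimal transport cost for $|x-y|^2$, infimized over the cone where a cone appears. $Q_2(\varphi)(x)=\inf_y\{\varphi(y)+|x-y|^2\}$, $Q_{\bar2}(\varphi)(y)=\sup_x\{\varphi(x)-|x-y|^2\}$. $\mathrm{S}_{b,2}$ (resp. $C_{b,2}$): measurable (resp. continuous) $u$ with $\sup|u(x)|/(1+|x|^2)<\infty$. $\mathcal{D}_2(\mu,\mathrm{P}^{cx}_{2,\le\nu})=\sup_{\varphi\in\mathcal{A}_{cx}\cap L^1(d\nu)}\{\int Q_2(\varphi)d\mu-\int\varphi d\nu\}$ (which equals the same supremum over $\mathcal{A}_{cx}\cap\mathrm{S}_{b,2}$), and $\mathcal{D}_2(\mathrm{P}^{cx}_{2,\mu\le},\nu)=\sup_{\varphi\in\mathcal{A}_{cx}\cap\mathrm{S}_{b,2}}\{\int\varphi d\mu-\int Q_{\bar2}(\varphi)d\nu\}$. *)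

(* Defs.v *)
(* R^d is modelled as the row-vector space 'rV[R]_d
   over an arbitrary realType R, equipped with its (product = Euclidean)
   topology and the Borel sigma-algebra generated by its open sets. *)
From HB Require Import structures.
From mathcomp Require Import all_boot all_order all_algebra.
From mathcomp Require Import all_classical all_reals all_analysis.
From mathcomp Require Import measurable_realfun.

Set Implicit Arguments.
Unset Strict Implicit.
Unset Printing Implicit Defensive.

Import Order.TTheory GRing.Theory Num.Theory.
Import numFieldTopology.Exports numFieldNormedType.Exports.

Local Open Scope classical_set_scope.
Local Open Scope ring_scope.

HB.instance Definition _ (R : realType) (d : nat) :=
  Measurable.copy 'rV[R]_d (g_sigma_algebraType (@open 'rV[R]_d)).

Definition sqn (R : realType) (d : nat) (x : 'rV[R]_d) : R :=
  \sum_(i < d) (x ord0 i) ^+ 2.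

Local Open Scope ereal_scope.

Definition P2 (R : realType) (d : nat) (mu : probability 'rV[R]_d R) : Prop :=
  \int[mu]_x (sqn x)%:E < +oo.

Definition integral_exists (R : realType) (d : nat)
    (mu : probability 'rV[R]_d R) (f : 'rV[R]_d -> \bar R) : Prop :=
  (\int[mu]_x (f^\+ x) < +oo) \/ (\int[mu]_x (f^\- x) < +oo).

Definition cx_le (R : realType) (d : nat) (mu nu : probability 'rV[R]_d R) : Prop :=
  forall phi : 'rV[R]_d -> R,
    @convex_function R 'rV[R]_d setT phi ->
    integral_exists mu (fun x => (phi x)%:E) ->
    integral_exists nu (fun x => (phi x)%:E) ->
    \int[mu]_x (phi x)%:E <= \int[nu]_x (phi x)%:E.

(* convexity of an extended-real valued function (never -oo) *)
Definition convex_ext (R : realType) (d : nat) (f : 'rV[R]_d -> \bar R) : Prop :=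
  forall (x y : 'rV[R]_d) (t : R), (0 < t)%R -> (t < 1)%R ->
    f (t *: x + (1 - t) *: y)%R <= t%:E * f x + (1 - t)%R%:E * f y.

Definition Acx (R : realType) (d : nat) (f : 'rV[R]_d -> \bar R) : Prop :=
  [/\ forall x, f x != -oo,
      exists x, f x \is a fin_num,
      lower_semicontinuous f &
      convex_ext f].

Definition Sb2 (R : realType) (d : nat) (u : 'rV[R]_d -> \bar R) : Prop :=
  measurable_fun setT u /\
  exists C : R, forall x, `|u x| <= (C * (1 + sqn x))%:E.

Definition Cb2 (R : realType) (d : nat) (u : 'rV[R]_d -> \bar R) : Prop :=
  continuous u /\
  exists C : R, forall x, `|u x| <= (C * (1 + sqn x))%:E.

Definition Q2 (R : realType) (d : nat) (phi : 'rV[R]_d -> \bar R) (x : 'rV[R]_d) : \bar R :=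
  ereal_inf (range (fun y => phi y + (sqn (x - y))%:E)).

Definition Qbar2 (R : realType) (d : nat) (phi : 'rV[R]_d -> \bar R) (y : 'rV[R]_d) : \bar R :=
  ereal_sup (range (fun x => phi x - (sqn (x - y))%:E)).

Definition coupling (R : realType) (d : nat) (mu nu : probability 'rV[R]_d R)
    (pi : probability ('rV[R]_d * 'rV[R]_d)%type R) : Prop :=
  forall A : set 'rV[R]_d, measurable A ->
    pi (A `*` setT) = mu A /\ pi (setT `*` A) = nu A.

Definition T2 (R : realType) (d : nat) (mu nu : probability 'rV[R]_d R) : \bar R :=
  ereal_inf [set \int[pi]_z (sqn (z.1 - z.2))%:E
            | pi in [set pi : probability ('rV[R]_d * 'rV[R]_d)%type R | coupling mu nu pi]].

Definition T2_up (R : realType) (d : nat) (mu nu : probability 'rV[R]_d R) : \bar R :=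
  ereal_inf [set T2 xi nu
            | xi in [set xi : probability 'rV[R]_d R | P2 xi /\ cx_le mu xi]].

Definition T2_down (R : realType) (d : nat) (mu nu : probability 'rV[R]_d R) : \bar R :=
  ereal_inf [set T2 mu eta
            | eta in [set eta : probability 'rV[R]_d R | P2 eta /\ cx_le eta nu]].

Definition D2_down (R : realType) (d : nat) (mu nu : probability 'rV[R]_d R) : \bar R :=
  ereal_sup [set \int[mu]_x Q2 phi x - \int[nu]_x phi x
            | phi in [set phi : 'rV[R]_d -> \bar R | Acx phi /\ nu.-integrable setT phi]].

Definition D2_up (R : realType) (d : nat) (mu nu : probability 'rV[R]_d R) : \bar R :=
  ereal_sup [set \int[mu]_x phi x - \int[nu]_x Qbar2 phi x
            | phi in [set phi : 'rV[R]_d -> \bar R | Acx phi /\ Sb2 phi]].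

(* Main.v *)
(* Weak duality integrates [Q2 phi x <= phi y + |x - y|^2] against a coupling;
   since the convex order only tests real-valued functions, an extended-valued
   [phi] is first replaced by its Moreau envelopes.  The equality of the two dual
   values comes from [phi <= Q2 (Qbar2 phi)] and [Qbar2 (Q2 phi) <= phi].

   Strong duality is semi-discrete.  Cut the space into finitely many cells of
   small [mu]-variance, with masses [p i] and means [m i], and consider all ways
   of splitting [nu] into pieces [q i * nu] with [\sum_i q i = 1].  The vectors of
   masses and first moments of the pieces form a convex set in finite dimension;
   near-optimality of a near-projection of the cell moments onto it, tested
   against the split induced by the maximum [lambda] of the finitely many affine
   functions read off the gradient, says exactly that [2 lambda] is almost as good
   in [D2_down] as the split.  After an exact correction of the masses, let [b x]
   be the barycenter of the piece attached to the cell of [x].  The law of [b X]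
   lies below [nu], and if [Y] follows the piece attached to the cell of [X], the
   law of [Y + X - b X] lies above [mu]; both have transport cost at most
   [E |X - b X|^2], which is [D2_down] up to an arbitrarily small error.  No
   compactness and no disintegration is needed. *)
Require Import Defs.
From HB Require Import structures.
From mathcomp Require Import all_boot all_order all_algebra.
From mathcomp Require Import all_classical all_reals all_analysis.
From mathcomp Require Import measurable_realfun ring lra.
Import Order.TTheory GRing.Theory Num.Theory.
Import numFieldTopology.Exports numFieldNormedType.Exports.
Local Open Scope classical_set_scope.
Local Open Scope ring_scope.

Set Implicit Arguments.
Unset Strict Implicit.

(** * Convex functions on R^d *)

Section Convex.
Context {R : realType}.

(** The quantity made small is $\sum_i p_i |m_i - b_i|^2$, with $b_i$ the barycenter of the piece
    attached to cell $i$; adding the within-cell variance turns it into the cost $E|X - bX|^2$. In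
    terms of first moments it is a squared distance with weights $1/p_i$, chosen so that the
    gradient has slope exactly $m_i - b_i$. A piece must also have mass $p_i$. Imposing this as a
    constraint would require a multiplier, so it is penalized with a large weight $K$, and the mass
    components of the gradient become the constant terms of the affine functions. The factor 2 in
    $2\lambda$ comes from the infimal convolution: for $l$ affine with slope $z$, $Q_2(2l) = 2l -
    |z|^2$. The pairing with the gradient yields the distance twice and the slope term removes one
    copy of its moment part, so what remains is the cost itself. Hahn-Banach enters only through
    subgradients of finite convex functions, which supply the affine minorants for semicontinuity,
    for the convex order and for Jensen's inequality on the pieces. *)

Definition conv_fun (V : lmodType R) (f : V -> R) := forall (x y : V) (t : R),
  0 < t -> t < 1 -> f (t *: x + (1 - t) *: y) <= t * f x + (1 - t) * f y.

Lemma convex_functionE (V : lmodType R) (f : V -> R) :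
  @convex_function R V setT f <-> conv_fun f.
Proof.
split=> [cf x y t t0 t1|cf t x y _ _].
- have t01 : (0 <= t <= 1)%R by rewrite !ltW.
  pose T : {i01 R} := Itv01 (ltW t0) (ltW t1).
  exact: (cf T x y (mem_setT _) (mem_setT _)).
- have : 0 <= t%:num by []; rewrite le_eqVlt => /predU1P [t0|t0].
    have -> : t = 0%:i01 by apply/val_inj; rewrite /= t0.
    by rewrite !conv0.
  have : t%:num <= 1 by []; rewrite le_eqVlt => /predU1P [t1|t1].
    have -> : t = 1%:i01 by apply/val_inj; rewrite /= t1.
    by rewrite !conv1.
  exact: cf.
Qed.

Lemma conv_translate (V : lmodType R) (x y z : V) (t : R) :
  t *: (x + z) + (1 - t) *: (y + z) = t *: x + (1 - t) *: y + z.
Proof. by rewrite !scalerDr addrACA -scalerDl [t + _]addrC subrK scale1r. Qed.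

(* One step of the finite-dimensional Hahn-Banach argument. *)
Lemma conv_fun_extend (V : lmodType R) (W : set V) (f : V -> R) (e : V) :
  W 0 -> (forall (a b : R) u v, W u -> W v -> W (a *: u + b *: v)) ->
  conv_fun f -> (forall w, W w -> 0 <= f w) ->  f 0 = 0 ->
  exists c : R, forall w s, W w -> s * c <= f (w + s *: e).
Proof.
move=> W0 Wl cf f0 f00.
have key w w' s s' : W w -> W w' -> 0 < s -> 0 < s' ->
    - (f (w - s *: e) / s) <= f (w' + s' *: e) / s'.
  move=> Ww Ww' s0 s'0; rewrite -subr_ge0 opprK.
  have ss0 : 0 < s + s' by rewrite addr_gt0.
  (* With this weight [t * s' = (1 - t) * s], so the [e] components cancel and the combination falls
     into [W], where [f] is nonnegative. *)
  pose t := s / (s + s').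
  have t0 : 0 < t by rewrite divr_gt0.
  have t1 : t < 1 by rewrite ltr_pdivrMr// mul1r ltrDl.
  have t1E : 1 - t = s' / (s + s') by rewrite /t; field; rewrite gt_eqF.
  have := cf (w' + s' *: e) (w - s *: e) t t0 t1.
  have -> : t *: (w' + s' *: e) + (1 - t) *: (w - s *: e) =
      t *: w' + (1 - t) *: w.
    rewrite !scalerDr scalerN !scalerA addrACA.
    have -> : t * s' = (1 - t) * s by rewrite t1E /t mulrAC [RHS]mulrAC [s * _]mulrC.
    by rewrite subrr addr0.
  move=> /(le_trans (f0 _ (Wl t (1 - t) _ _ Ww' Ww))).
  rewrite t1E /t => h.
  have -> : f (w' + s' *: e) / s' + f (w - s *: e) / s =
     (s / (s + s') * f (w' + s' *: e) + s' / (s + s') * f (w - s *: e)) *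
     ((s + s') / (s * s')).
    by field; rewrite !gt_eqF // s0 s'0 ss0.
  by rewrite mulr_ge0// divr_ge0 ?mulr_ge0// ltW.
pose A : set R := [set x | exists w s, [/\ W w, 0 < s & x = - (f (w - s *: e) / s)]].
have A0 : A !=set0 by exists (- (f (0 - 1 *: e) / 1)), 0, 1.
have Aub w' s' : W w' -> 0 < s' -> ubound A (f (w' + s' *: e) / s').
  by move=> Ww' s'0 _ [w [s [Ww s0 ->]]]; exact: key.
have Asup : has_sup A by split => //; exists (f (0 + 1 *: e) / 1); exact: Aub.
(* An admissible slope lies above every left quotient (the elements of [A]) and below every right
   one; [sup A] is the smallest such slope. *)
exists (sup A) => w s Ww.
have [s0|s0|s0] := ltrgtP 0 s.
- rewrite mulrC -ler_pdivlMr//; apply: ge_sup => //; exact: Aub.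
- have : - (f (w - (- s) *: e) / (- s)) <= sup A.
    by apply: sup_ubound; [case: Asup|exists w, (- s); split => //; rewrite oppr_gt0].
  rewrite scaleNr opprK invrN mulrN opprK.
  by rewrite ler_ndivrMr// mulrC.
- by rewrite -s0 mul0r scale0r addr0 f0.
Qed.

End Convex.

(** * Inner product, squared norm and subgradients *)

Section Euclid.
Context {R : realType} {d : nat}.
Implicit Types x y z u v : 'rV[R]_d.

Definition dot u v : R := \sum_(i < d) u ord0 i * v ord0 i.

Lemma sqn_ge0 x : 0 <= sqn x.
Proof. by apply: sumr_ge0 => i _; exact: sqr_ge0. Qed.

Lemma sqn0 : sqn (0 : 'rV[R]_d) = 0.
Proof. by apply: big1 => i _; rewrite mxE expr0n. Qed.

Lemma sqnN x : sqn (- x) = sqn x.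
Proof. by apply: eq_bigr => i _; rewrite mxE sqrrN. Qed.

Lemma sqnB x y : sqn (x - y) = sqn (y - x).
Proof. by rewrite -sqnN opprB. Qed.

Lemma sqnD_le x y : sqn (x + y) <= 2 * sqn x + 2 * sqn y.
Proof.
rewrite /sqn !mulr_sumr -big_split /=; apply: ler_sum => i _; rewrite !mxE.
have := sqr_ge0 (x ord0 i - y ord0 i); nra.
Qed.

Lemma sqnB_le x y : sqn (x - y) <= 2 * sqn x + 2 * sqn y.
Proof. by rewrite -(sqnN y) sqnD_le. Qed.

Lemma dotDl u v x : dot (u + v) x = dot u x + dot v x.
Proof. by rewrite /dot -big_split; apply: eq_bigr => i _; rewrite mxE mulrDl. Qed.

Lemma dotZl a u x : dot (a *: u) x = a * dot u x.
Proof. by rewrite /dot mulr_sumr; apply: eq_bigr => i _; rewrite mxE mulrA. Qed.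

Lemma dotC u v : dot u v = dot v u.
Proof. by apply: eq_bigr => i _; rewrite mulrC. Qed.

Lemma dotDr u v x : dot x (u + v) = dot x u + dot x v.
Proof. by rewrite dotC dotDl !(dotC x). Qed.

Lemma dotZr a u x : dot x (a *: u) = a * dot x u.
Proof. by rewrite dotC dotZl dotC. Qed.

Lemma dotNr u x : dot x (- u) = - dot x u.
Proof. by rewrite -scaleN1r dotZr mulN1r. Qed.

Lemma dot0r x : dot x 0 = 0.
Proof. by apply: big1 => i _; rewrite mxE mulr0. Qed.

Lemma dot_delta (i : 'I_d) x : dot (delta_mx ord0 i) x = x ord0 i.
Proof.
rewrite /dot (bigD1 i)//= mxE !eqxx mul1r big1 ?addr0// => j ji.
by rewrite mxE (negbTE ji) andbF mul0r.
Qed.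

Lemma conv_fun_affine (f : 'rV[R]_d -> R) (a : R) b g :
  conv_fun f -> conv_fun (fun u => f (b + u) - a - dot g u).
Proof.
move=> cf x y t t0 t1.
have -> : b + (t *: x + (1 - t) *: y) = t *: (b + x) + (1 - t) *: (b + y).
  by rewrite !scalerDr addrACA -scalerDl [t + _]addrC subrK scale1r.
have := cf (b + x) (b + y) t t0 t1.
rewrite dotDr !dotZr; lra.
Qed.

(** Induction on the number [k] of leading coordinates in which the increment may be nonzero: each
    extension step supplies the slope along one more basis vector, and [k = d] leaves no
    restriction. *)
Lemma subgradient (f : 'rV[R]_d -> R) (b : 'rV[R]_d) : conv_fun f ->
  exists g : 'rV[R]_d, forall y, f b + dot g (y - b) <= f y.
Proof.
move=> cf.
suff H k : exists g : 'rV[R]_d, forall u, (forall i : 'I_d, (k <= i)%N -> u ord0 i = 0) ->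
    f b + dot g u <= f (b + u).
  have [g hg] := H d; exists g => y; have := hg (y - b); rewrite [b + _]addrC subrK; apply => i.
  by rewrite leqNgt ltn_ord.
elim: k => [|k [g hg]].
  exists 0 => u u0; have -> : u = 0 by apply/rowP => i; rewrite u0// mxE.
  by rewrite dot0r !addr0.
have [kd|dk] := ltnP k d; last first.
  exists g => u _; apply: hg => i ki.
  by have := ltn_ord i; rewrite ltnNge (leq_trans dk ki).
pose W : set 'rV[R]_d := [set u | forall i : 'I_d, (k <= i)%N -> u ord0 i = 0].
pose e : 'rV[R]_d := delta_mx ord0 (Ordinal kd).
have [||||c hc] := @conv_fun_extend R 'rV[R]_d W _ e _ _
    (conv_fun_affine (f b) b g cf).
- by move=> i _; rewrite mxE.
- by move=> s t u v Wu Wv i ki; rewrite !mxE Wu// Wv// !mulr0 addr0.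
- by move=> w /hg; lra.
- by rewrite addr0 dot0r subrr subr0.
exists (g + c *: e) => u hu.
pose s := u ord0 (Ordinal kd).
have Wu : W (u - s *: e).
  move=> i; rewrite leq_eqVlt => /predU1P [ki|ki].
    have -> : i = Ordinal kd by apply: val_inj; rewrite /= ki.
    by rewrite !mxE !eqxx mulr1 subrr.
  rewrite !mxE hu// eqxx/= (_ : _ == _ = false) ?mulr0 ?subr0//.
  by apply/negbTE; rewrite -val_eqE/= neq_ltn ki orbT.
have := hc _ s Wu; rewrite subrK dotDl dotZl dot_delta -/s; lra.
Qed.

End Euclid.

(** * Infimal and supremal convolution with the squared distance *)

Section Regularity.
Context {R : realType} {d : nat}.
Implicit Types x y z u v : 'rV[R]_d.
Local Open Scope ereal_scope.

Lemma measurable_lsc (f : 'rV[R]_d -> \bar R) :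
  lower_semicontinuous f -> measurable_fun setT f.
Proof.
move=> scif; apply: (measurability _ (ErealGenOInfty.measurableE R)).
move=> /= _ [_ [a ->]] <-; apply: measurableI => //.
apply: sub_sigma_algebra => /=.
by rewrite preimage_itvoy; move/lower_semicontinuousP : scif; exact.
Qed.

Lemma lsc_continuous (f : 'rV[R]_d -> R) :
  continuous f -> lower_semicontinuous (EFin \o f).
Proof.
move=> cf x a /=; rewrite lte_fin => ax.
exists [set y | (a < f y)%R] => //=.
have := cf x; move/cvgrPdist_lt => /(_ (f x - a)%R); rewrite subr_gt0 => /(_ ax).
apply: filterS => y /= h; have := le_lt_trans (ler_norm _) h; lra.
Qed.

Lemma measurable_continuous (f : 'rV[R]_d -> R) :
  continuous f -> measurable_fun setT f.
Proof. by move=> cf; apply/measurable_EFinP; apply: measurable_lsc; exact: lsc_continuous. Qed.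

Lemma measurable_coord (i : 'I_d) :
  measurable_fun setT (fun x : 'rV[R]_d => x ord0 i).
Proof. by apply: measurable_continuous; exact: coord_continuous. Qed.

Let cstc (a : R) : continuous (fun _ : 'rV[R]_d => a).
Proof. exact: cst_continuous. Qed.

Let contD (f g : 'rV[R]_d -> R) :
  continuous f -> continuous g -> continuous (fun x => f x + g x)%R.
Proof. by move=> cf cg x; exact: (cvgD (cf x) (cg x)). Qed.

Let contM (f g : 'rV[R]_d -> R) :
  continuous f -> continuous g -> continuous (fun x => f x * g x)%R.
Proof. by move=> cf cg x; exact: (cvgM (cf x) (cg x)). Qed.

Let contc (i : 'I_d) : continuous (fun x : 'rV[R]_d => x ord0 i).
Proof. exact: coord_continuous. Qed.

Lemma continuous_sum (I : Type) (s : seq I) (f : I -> 'rV[R]_d -> R) :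
  (forall i, continuous (f i)) -> continuous (fun x => (\sum_(i <- s) f i x)%R).
Proof.
move=> cf; elim: s => [|i s ih].
  rewrite (_ : (fun x => _) = cst 0%R); first exact: cst_continuous.
  by apply/funext => x; rewrite big_nil.
rewrite (_ : (fun x => _) = (fun x => f i x + \sum_(j <- s) f j x)%R); last first.
  by apply/funext => x; rewrite big_cons.
exact: contD.
Qed.

Lemma continuous_affine (g b : 'rV[R]_d) (a : R) :
  continuous (fun y : 'rV[R]_d => (a + dot g (y - b))%R).
Proof.
apply: contD; first exact: cstc.
apply: continuous_sum => i; apply: contM; first exact: cstc.
rewrite (_ : (fun x : 'rV[R]_d => _) = (fun x : 'rV[R]_d => x ord0 i + - b ord0 i)%R).
  by apply: contD; [exact: contc|exact: cstc].
by apply/funext => w; rewrite !mxE.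
Qed.

Lemma continuous_sqnB x : continuous (fun y : 'rV[R]_d => sqn (x - y)).
Proof.
apply: continuous_sum => i.
rewrite (_ : (fun y : 'rV[R]_d => _) =
  (fun y : 'rV[R]_d => (y ord0 i + - x ord0 i) * (y ord0 i + - x ord0 i))%R).
  by apply: contM; apply: contD; (try exact: cstc); exact: contc.
by apply/funext => w; rewrite !mxE; ring.
Qed.

(** A subgradient at [x] gives a continuous affine minorant that touches [f] at [x]. *)
Lemma conv_fun_lsc (f : 'rV[R]_d -> R) :
  conv_fun f -> lower_semicontinuous (EFin \o f).
Proof.
move=> cf x a /= ax; have [g gP] := subgradient x cf.
have := lsc_continuous (@continuous_affine g x (f x)).
move=> /(_ x a) /=; rewrite subrr dot0r addr0 => /(_ ax) [V Vx hV].
by exists V => // y /hV; rewrite !lte_fin => /lt_le_trans; apply.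
Qed.

Lemma conv_fun_Acx (f : 'rV[R]_d -> R) : conv_fun f -> Acx (EFin \o f).
Proof.
move=> cf; split=> //; [by exists 0%R|exact: conv_fun_lsc].
Qed.

Lemma Acx_conv_fun (f : 'rV[R]_d -> R) : Acx (EFin \o f) -> conv_fun f.
Proof.
by move=> [_ _ _ cf] x y t t0 t1; have := cf x y t t0 t1; rewrite /= -!EFinM -EFinD lee_fin.
Qed.

(** The norm on row vectors is the maximum norm, attained at some coordinate unless it vanishes;
    this links topological balls to the Euclidean [sqn]. *)
Lemma sqr_norm_le_sqn x : (`|x| ^+ 2 <= sqn x)%R.
Proof.
have [->|x0] := eqVneq `|x|%R 0%R; first by rewrite expr0n sqn_ge0.
have [[i j] /= xE] := mx_norm_neq0 x0.
rewrite /Num.norm/= xE real_normK ?num_real// /sqn (bigD1 j)//= ord1 lerDl.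
by apply: sumr_ge0 => k _; exact: sqr_ge0.
Qed.

Lemma sqn_conv x y t : (0 <= t -> t <= 1 ->
  sqn (t *: x + (1 - t) *: y) <= t * sqn x + (1 - t) * sqn y)%R.
Proof.
move=> t0 t1; rewrite /sqn !mulr_sumr -big_split; apply: ler_sum => i _.
rewrite !mxE /=; set a := x _ _; set b := y _ _.
rewrite -subr_ge0; have -> : (t * a ^+ 2 + (1 - t) * b ^+ 2 - (t * a + (1 - t) * b) ^+ 2 =
   t * (1 - t) * (a - b) ^+ 2)%R by ring.
by rewrite mulr_ge0 ?sqr_ge0// mulr_ge0// subr_ge0.
Qed.

End Regularity.

Section InfConvolution.
Context {R : realType} {d : nat}.
Implicit Types (x y z u v : 'rV[R]_d) (phi : 'rV[R]_d -> \bar R).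
Local Open Scope ereal_scope.

Lemma Q2_le phi x y : Q2 phi x <= phi y + (sqn (x - y))%:E.
Proof. by apply: ereal_inf_lbound; exists y. Qed.

Lemma Qbar2_ge phi x y : phi x - (sqn (x - y))%:E <= Qbar2 phi y.
Proof. by apply: ereal_sup_ubound; exists x. Qed.

Lemma Qbar2_ge_id phi y : phi y <= Qbar2 phi y.
Proof. by have := Qbar2_ge phi y y; rewrite subrr sqn0 sube0. Qed.

(* Lower semicontinuity at one finite point bounds [phi] below on a small ball;
   convexity propagates this to a linear lower bound everywhere. *)
Lemma Acx_linear_lower phi : Acx phi -> exists (y0 : 'rV[R]_d) (r delta : R),
  [/\ (0 < delta)%R, phi y0 = r%:E &
   forall y, (r - 1 - 2 * `|y - y0| / delta)%:E <= phi y].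
Proof.
move=> [phiNy [y0 fy0] lscphi cphi]; have [V /nbhs_ballP[/= dl dl0 dV] hV] :=
  lscphi y0 (fine (phi y0) - 1)%R ltac:(by rewrite -{2}(fineK fy0) lte_fin; lra).
exists y0, (fine (phi y0)), dl; rewrite fineK//; split => // y.
set r := fine _ in hV *.
have {}hV z : (`|z - y0| < dl)%R -> (r - 1)%:E < phi z.
  by move=> h; apply/hV/dV; rewrite -ball_normE /ball_ /= distrC.
have [yd|dy] := ltP `|y - y0|%R dl.
  apply: (le_trans _ (ltW (hV _ yd))); rewrite lee_fin lerBlDr lerDl.
  by rewrite divr_ge0 ?mulr_ge0// ltW.
have N0 : (0 < `|y - y0|)%R by exact: lt_le_trans dy.
(* Moves from [y0] towards [y] by a distance [dl / 2], hence inside the ball where [phi] exceeds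
   [r - 1]; convexity then transfers the bound to [y]. *)
pose s := (dl / (2 * `|y - y0|))%R.
have s0 : (0 < s)%R by rewrite divr_gt0// mulr_gt0.
have s1 : (s < 1)%R by rewrite ltr_pdivrMr ?mulr_gt0// mul1r; lra.
have zE : (s *: y + (1 - s) *: y0 - y0 = s *: (y - y0))%R.
  by rewrite scalerBl scale1r scalerBr addrA [(s *: y + y0)%R]addrC -!addrA addrCA; congr (_ + _)%R; rewrite addrA addrC addKr.
have hz : (`|s *: y + (1 - s) *: y0 - y0| < dl)%R.
  by rewrite zE normrZ gtr0_norm// /s mulrAC ltr_pdivrMr ?mulr_gt0//; nra.
have := lt_le_trans (hV _ hz) (cphi y y0 s s0 s1).
have -> : (2 * `|y - y0| / dl = s^-1)%R by rewrite /s invf_div.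
rewrite -(fineK fy0) -/r; case: (phi y) (phiNy y) => [w| |] _ //; last by rewrite leey.
rewrite -!EFinM -EFinD lte_fin lee_fin => h.
have : (r - s^-1 < w)%R by rewrite -(ltr_pM2l s0) mulrBr divff ?gt_eqF//; lra.
lra.
Qed.

(** The linear loss of [phi] is absorbed by part of the squared distance. The bound is uniform in
    [y], which makes [Q2 phi] finite with quadratic growth. *)
Lemma Acx_quad_lower phi : Acx phi -> exists (y0 : 'rV[R]_d) (r c : R),
  phi y0 = r%:E /\
  forall x y, (c - 2^-1 * sqn (x - y0))%:E <= phi y + (sqn (x - y))%:E.
Proof.
move=> /Acx_linear_lower[y0 [r [dl [dl0 r0 h]]]].
exists y0, r, (r - 1 - 4 * dl^-1 ^+ 2)%R; split=> // x y.
apply: le_trans (leeD2r _ (h y)); rewrite -EFinD lee_fin.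
have h1 := sqr_norm_le_sqn (y - y0).
have h2 : (sqn (y - y0) <= 2 * sqn (x - y) + 2 * sqn (x - y0))%R.
  have -> : (y - y0 = (x - y0) - (x - y))%R by rewrite [RHS]addrC opprB addrA subrK.
  by rewrite [leRHS]addrC sqnB_le.
have h3 := sqn_ge0 (x - y).
(* This square gives $2ND \le N^2/4 + 4D^2$; with [h1] and [h2], $N^2/4$ costs at most half of
   [sqn (x - y)] plus half of [sqn (x - y0)]. *)
have := sqr_ge0 (2^-1 * `|y - y0| - 2 * dl^-1)%R.
set N := `|_|%R in h1 *; set D := (dl^-1)%R; rewrite -/D => h4.
have {h4} : (2 * N * D <= 4^-1 * N ^+ 2 + 4 * D ^+ 2)%R by nra.
lra.
Qed.

Lemma Q2_bounds phi : Acx phi -> exists (y0 : 'rV[R]_d) (r c : R), forall x,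
  (c - 2^-1 * sqn (x - y0))%:E <= Q2 phi x <= (r + sqn (x - y0))%:E.
Proof.
move=> /Acx_quad_lower[y0 [r [c [r0 h]]]]; exists y0, r, c => x.
apply/andP; split.
  by apply: le_ereal_inf_tmp => _ [y _ <-]; exact: h.
by have := Q2_le phi x y0; rewrite r0.
Qed.

Lemma Q2_fin_num phi x : Acx phi -> Q2 phi x \is a fin_num.
Proof.
move=> /Q2_bounds[y0 [r [c /(_ x)/andP[h1 h2]]]].
by rewrite fin_numE gt_eqF ?(lt_le_trans _ h1) ?ltNyr// lt_eqF// (le_lt_trans h2) ?ltry.
Qed.

Lemma Q2_near phi x (e : R) : Acx phi -> (0 < e)%R ->
  exists (y : 'rV[R]_d) (r : R), phi y = r%:E /\ (r + sqn (x - y) < fine (Q2 phi x) + e)%R.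
Proof.
move=> Aphi e0; have [_ [y _ <-]] := lb_ereal_inf_adherent e0 (Q2_fin_num x Aphi).
rewrite -/(Q2 phi x) -(fineK (Q2_fin_num x Aphi)).
case: Aphi => phiNy _ _ _; case phiE: (phi y) (phiNy y) => [r| |] _ // h.
by exists y, r; split => //; move: h; rewrite -!EFinD lte_fin.
Qed.

(** Partial minimization of a jointly convex function: the convex combination of near-minimizers for
    [x] and [y] is a competitor for the combined point. *)
Lemma Q2_conv phi : Acx phi -> conv_fun (fun x => fine (Q2 phi x)).
Proof.
move=> Aphi x y t t0 t1; apply/ler_addgt0Pr => e e0.
have [u [r [ru hu]]] := Q2_near x Aphi e0.
have [v [s [sv hv]]] := Q2_near y Aphi e0.
have [_ _ _ /(_ u v t t0 t1)] := Aphi; rewrite ru sv => h.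
have := Q2_le phi (t *: x + (1 - t) *: y) (t *: u + (1 - t) *: v).
move=> /le_trans/(_ (leeD2r _ h)).
rewrite -(fineK (Q2_fin_num _ Aphi)) -!EFinM -!EFinD lee_fin => /le_trans; apply.
have -> : (t *: x + (1 - t) *: y - (t *: u + (1 - t) *: v) =
   t *: (x - u) + (1 - t) *: (y - v))%R by rewrite !scalerBr opprD addrACA.
have := sqn_conv (x - u) (y - v) (ltW t0) (ltW t1); nra.
Qed.

Lemma Q2_EFin phi : Acx phi -> Q2 phi = EFin \o (fun x => fine (Q2 phi x)).
Proof. by move=> Aphi; apply/funext => x /=; rewrite fineK// Q2_fin_num. Qed.

Lemma Q2_Acx phi : Acx phi -> Acx (Q2 phi).
Proof. by move=> Aphi; rewrite Q2_EFin//; exact/conv_fun_Acx/Q2_conv. Qed.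

Lemma Q2_Sb2 phi : Acx phi -> Sb2 (Q2 phi).
Proof.
move=> Aphi; split; first by apply: measurable_lsc; case: (Q2_Acx Aphi).
have [y0 [r [c h]]] := Q2_bounds Aphi.
exists (`|r| + `|c| + 2 + 2 * sqn y0)%R => x; have /andP[h1 h2] := h x.
move: h1 h2; rewrite -(fineK (Q2_fin_num x Aphi)) !lee_fin ler_norml => h1 h2.
have := sqnB_le x y0; have := sqn_ge0 x; have := sqn_ge0 y0; have := sqn_ge0 (x - y0).
have := ler_norm r; have := ler_norm (- c); rewrite normrN.
have := normr_ge0 r; have := normr_ge0 c => *.
by apply/andP; split; nra.
Qed.

Lemma Qbar2_lsc phi : Acx phi -> lower_semicontinuous (Qbar2 phi).
Proof.
move=> [phiNy _ _ _] y a /ereal_sup_gt [_ [x _ <-]].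
case phiE: (phi x) (phiNy x) => [r| |] _ //; last first.
  move=> _; exists setT => [|z _]; first exact: (@filterT _ (nbhs y)).
  by apply: lt_le_trans (Qbar2_ge phi x z); rewrite phiE ltry.
rewrite -EFinB => ax.
have cf : continuous (fun z : 'rV[R]_d => (r - sqn (x - z))%R).
  by move=> z; exact: (cvgB (cvg_cst r) (@continuous_sqnB _ _ x z)).
have [V Vy hV] := lsc_continuous cf ax; exists V => // z /hV /lt_le_trans; apply.
by apply: le_trans (Qbar2_ge phi x z); rewrite phiE.
Qed.

(** Parametrized by the displacement [z] instead of the point [w], the supremum runs over translates
    of [phi] minus the constants [sqn z]; the concave quadratic term no longer depends on the
    variable. *)
Lemma Qbar2_convex phi : Acx phi -> convex_ext (Qbar2 phi).
Proof.
move=> [phiNy _ _ cphi] x y t t0 t1; apply: ge_ereal_sup => _ [w _ <-].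
pose z := (w - (t *: x + (1 - t) *: y))%R.
have -> : w = (t *: (x + z) + (1 - t) *: (y + z))%R.
  by rewrite conv_translate /z addrC subrK.
have -> : (t *: (x + z) + (1 - t) *: (y + z) - (t *: x + (1 - t) *: y) = z)%R.
  by rewrite conv_translate addrAC subrr add0r.
apply: le_trans (leeB (cphi _ _ _ t0 t1) (lexx _)) _.
have hx := Qbar2_ge phi (x + z) x; have hy := Qbar2_ge phi (y + z) y.
rewrite !(addrAC _ z) !subrr !add0r in hx hy.
apply: (@le_trans _ _ (t%:E * (phi (x + z)%R - (sqn z)%:E) +
                       (1 - t)%R%:E * (phi (y + z)%R - (sqn z)%:E))); last first.
  by apply: leeD; rewrite lee_pmul2l ?lte_fin ?subr_gt0.
have t1' : (0 < 1 - t)%R by rewrite subr_gt0.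
case: (phi (x + z)%R) (phiNy (x + z)%R) => [r| |] _ //; last first.
  suff -> : t%:E * (+oo - (sqn z)%:E) + (1 - t)%:E * (phi (y + z)%R - (sqn z)%:E) = +oo.
    exact: leey.
  rewrite [+oo - _]addye// gt0_muley ?lte_fin//.
  case: (phi (y + z)%R) (phiNy (y + z)%R) => [s| |] _ //.
  by rewrite [+oo - _]addye// gt0_muley ?lte_fin.
case: (phi (y + z)%R) (phiNy (y + z)%R) => [s| |] _ //; last first.
  by rewrite [(+oo - _)%E]addye// gt0_muley ?lte_fin// [leRHS]addey ?leey.
by rewrite -!EFinB -!EFinM -!EFinD lee_fin; nra.
Qed.

Lemma Qbar2_Acx phi : Acx phi -> (exists y, Qbar2 phi y \is a fin_num) -> Acx (Qbar2 phi).
Proof.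
move=> Aphi fQ; split => //; [|exact: Qbar2_lsc|exact: Qbar2_convex].
move=> y; rewrite gt_eqF//; apply: lt_le_trans (Qbar2_ge_id phi y).
by rewrite ltNye; case: Aphi.
Qed.

Lemma Q2_Qbar2_ge phi x : Acx phi -> phi x <= Q2 (Qbar2 phi) x.
Proof.
move=> _; apply: le_ereal_inf_tmp => _ [y _ <-].
by rewrite -leeBlDr// Qbar2_ge.
Qed.

Lemma Qbar2_Q2_le phi y : Qbar2 (Q2 phi) y <= phi y.
Proof.
by apply: ge_ereal_sup => _ [x _ <-]; rewrite leeBlDr// Q2_le.
Qed.

End InfConvolution.

(** * Densities and laws *)

Section Density.
Context d (T : measurableType d) (R : realType) (mu : {measure set T -> \bar R}).
Variables (h : T -> R) (mh : measurable_fun setT h) (h0 : forall x, 0 <= h x).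
Local Open Scope ereal_scope.

(** The measurability and positivity proofs are arguments so that the measure structure declared
    below can be attached to the term itself. *)
Definition density of measurable_fun setT h & (forall x, (0 <= h x)%R) :=
  fun A : set T => \int[mu]_(x in A) (h x)%:E.
Local Notation dens := (density mh h0).

Let mEh (D : set T) : measurable_fun D (EFin \o h).
Proof. by apply: measurable_funTS; exact/measurable_EFinP. Qed.

Let dens0 : dens set0 = 0.
Proof. by rewrite /density integral_set0. Qed.

Let dens_ge0 A : 0 <= dens A.
Proof. by apply: integral_ge0 => x _; rewrite lee_fin. Qed.

Let dens_sigma_additive : semi_sigma_additive dens.
Proof.
move=> /= F mF tF mUF; rewrite /density ge0_integral_bigcup//.
  by apply: is_cvg_ereal_nneg_natsum_cond => n _ _; exact: dens_ge0.
by move=> x _; rewrite lee_fin.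
Qed.

HB.instance Definition _ := isMeasure.Build _ _ _
  dens dens0 dens_ge0 dens_sigma_additive.

Let integral_density_indic (A : set T) : measurable A ->
  \int[dens]_x (\1_A x)%:E = \int[mu]_x ((\1_A x)%:E * (h x)%:E).
Proof.
move=> mA; rewrite integral_indic// setIT /= /density integral_mkcond.
apply: eq_integral => x _; rewrite patchE indicE; case: ifPn => _.
- by rewrite mul1e.
- by rewrite mul0e.
Qed.

Import HBNNSimple.

Let integral_density_nnsfun (f : {nnsfun T >-> R}) :
  \int[dens]_x (f x)%:E = \int[mu]_x ((f x)%:E * (h x)%:E).
Proof.
under [in LHS]eq_integral do rewrite fimfunE -fsumEFin//.
rewrite ge0_integral_fsum//; last 2 first.
  - by move=> r; exact/measurable_EFinP/measurableT_comp.
  - by move=> r z _; rewrite EFinM nnfun_muleindic_ge0.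
have -> : \int[mu]_x ((f x)%:E * (h x)%:E) =
  \int[mu]_x (\sum_(r \in range f) ((r * \1_(f @^-1` [set r]) x)%:E * (h x)%:E)).
  apply: eq_integral => x _.
  rewrite -ge0_mule_fsuml; last by move=> r; rewrite EFinM nnfun_muleindic_ge0.
  by rewrite {1}fimfunE -fsumEFin.
rewrite ge0_integral_fsum//; last 2 first.
  - move=> r; apply: emeasurable_funM; last exact: mEh.
    by apply/measurable_EFinP/measurableT_comp.
  - by move=> r z _; rewrite mule_ge0 ?lee_fin// -lee_fin EFinM nnfun_muleindic_ge0.
apply: eq_fsbigr => r _.
under [in RHS]eq_integral do rewrite EFinM -muleA.
rewrite (integralZl_indic _ (fun r => f @^-1` [set r]))//; last first.
  by move=> r0; rewrite preimage_nnfun0.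
rewrite integral_density_indic//.
have [r0|r0] := leP 0%R r.
  rewrite ge0_integralZl//.
    by apply: emeasurable_funM; [exact/measurable_EFinP|exact: mEh].
  by move=> x _; rewrite mule_ge0 ?lee_fin.
rewrite !integral0_eq ?mule0// => x _; rewrite preimage_nnfun0// indic0 mul0e//.
by rewrite mule0.
Qed.

(** Passes from indicators to simple functions by linearity, then to [f] by monotone convergence on
    both sides. *)
Lemma ge0_integral_density (f : T -> \bar R) : measurable_fun setT f ->
  (forall x, 0 <= f x) -> \int[dens]_x f x = \int[mu]_x (f x * (h x)%:E).
Proof.
move=> mf f0; pose f_ := nnsfun_approx measurableT mf.
transitivity (\int[dens]_z (lim ((f_ n z)%:E @[n --> \oo]))).
  by apply/eq_integral => z _; apply/esym/cvg_lim => //=; exact: cvg_nnsfun_approx.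
rewrite monotone_convergence//; last 3 first.
  by move=> n; exact/measurable_EFinP.
  by move=> n z _; rewrite lee_fin.
  by move=> z _ a b ab; rewrite lee_fin; exact/lefP/nd_nnsfun_approx.
rewrite (_ : (fun _ => _) =
    (fun n => \int[mu]_x ((f_ n x)%:E * (h x)%:E)))//; last first.
  by apply/funext => n; exact: integral_density_nnsfun.
rewrite -monotone_convergence//; last 3 first.
- by move=> n; apply: emeasurable_funM; [exact/measurable_EFinP|exact: mEh].
- by move=> n x _; rewrite mule_ge0// lee_fin.
- move=> x _ a b ab; rewrite lee_wpmul2r ?lee_fin//.
  exact/lefP/nd_nnsfun_approx.
apply: eq_integral => x _; apply/cvg_lim => //.
by apply: cvgeZr => //; exact: cvg_nnsfun_approx.
Qed.

End Density.

Section DensityProbability.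
Context d (T : measurableType d) (R : realType) (mu : {measure set T -> \bar R}).
Variables (h : T -> R) (mh : measurable_fun setT h) (h0 : forall x, 0 <= h x).
Hypothesis h1 : (\int[mu]_x (h x)%:E = 1)%E.

Definition densityP of (\int[mu]_x (h x)%:E = 1)%E : set T -> \bar R :=
  density mu mh h0.
Local Notation dens := (densityP h1).

HB.instance Definition _ := Measure.copy dens (density mu mh h0).

Let dens_setT : dens setT = 1%E.
Proof. exact: h1. Qed.

HB.instance Definition _ := @Measure_isProbability.Build _ _ R dens dens_setT.

End DensityProbability.

Section Law.
Context d1 d2 (T1 : measurableType d1) (T2 : measurableType d2) (R : realType).
Variables (P : probability T1 R) (X : T1 -> T2) (mX : measurable_fun setT X).
Local Open Scope ereal_scope.

Definition law : probability T2 R :=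
  distribution P (MeasurableFun.Pack (MeasurableFun.Class
    (isMeasurableFun.Build _ _ _ _ _ mX))).

Lemma ge0_integral_law (f : T2 -> \bar R) : measurable_fun setT f ->
  (forall y, 0 <= f y) -> \int[law]_y f y = \int[P]_x f (X x).
Proof. by move=> mf f0; rewrite ge0_integral_distribution. Qed.

End Law.

Section SameLaw.
Context d1 d2 (T1 : measurableType d1) (T2 : measurableType d2) (R : realType).
Variables (P : probability T1 R) (Q : probability T2 R) (X : T1 -> T2).
Hypotheses (mX : measurable_fun setT X)
  (PQ : forall A, measurable A -> P (X @^-1` A) = Q A).
Local Open Scope ereal_scope.

Lemma ge0_integral_same (f : T2 -> \bar R) : measurable_fun setT f ->
  (forall y, 0 <= f y) -> \int[P]_x f (X x) = \int[Q]_y f y.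
Proof.
move=> mf f0; rewrite -(ge0_integral_law _ mX)//.
by apply: eq_measure_integral => A mA _; exact: PQ.
Qed.

Lemma integral_same (f : T2 -> \bar R) : measurable_fun setT f ->
  \int[P]_x f (X x) = \int[Q]_y f y.
Proof.
move=> mf; rewrite [LHS]integralE [RHS]integralE; congr (_ - _).
- rewrite -(ge0_integral_same (f := f^\+))//; last exact: measurable_funepos.
  by apply: eq_integral => x _; rewrite -[fun x => f (X x)]/(f \o X) funepos_comp.
- rewrite -(ge0_integral_same (f := f^\-))//; last exact: measurable_funeneg.
  by apply: eq_integral => x _; rewrite -[fun x => f (X x)]/(f \o X) funeneg_comp.
Qed.

Lemma integrable_same (f : T2 -> \bar R) : Q.-integrable setT f ->
  P.-integrable setT (fun x => f (X x)).
Proof.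
move=> /integrableP[mf fi]; apply/integrableP; split.
  exact: measurableT_comp.
rewrite (ge0_integral_same (f := fun y => `|f y|))//.
exact: measurableT_comp.
Qed.

End SameLaw.

Lemma integral_cst_prob d (T : measurableType d) (R : realType)
  (P : probability T R) (r : R) : (\int[P]_x r%:E = r%:E)%E.
Proof. by rewrite integral_cst// [X in (_ * X)%E](probability_setT P) mule1. Qed.

Section IntegrableMinorant.
Context d (T : measurableType d) (R : realType) (m : {measure set T -> \bar R}).
Local Open Scope ereal_scope.

(** The negative part of [f] is dominated by that of [a], hence has finite integral; an integral of
    [f] below [+oo] then forces the positive part to be integrable too. *)
Lemma integrable_minorant (f a : T -> \bar R) : measurable_fun setT f ->
  m.-integrable setT a -> (forall x, a x <= f x) -> \int[m]_x f x < +oo ->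
  m.-integrable setT f.
Proof.
move=> mf ia af fi; apply/integrableP; split => //.
have hneg : \int[m]_x (f^\- x) < +oo.
  apply: (le_lt_trans _ (integral_funeneg_lt_pinfty measurableT ia)).
  apply: ge0_le_integral => //.
  - exact: measurable_funeneg.
  - by apply: measurable_funeneg; exact: measurable_int ia.
  - move=> x _; rewrite !funenegE ge_max !le_max leeN2 af/=.
    by rewrite lexx orbT.
under eq_integral do rewrite -[abse _]/((abse \o f) _) fune_abse.
rewrite ge0_integralD//; last 2 first.
- exact: measurable_funepos.
- exact: measurable_funeneg.
apply: lte_add_pinfty => //; move: fi; rewrite integralE.
have : 0 <= \int[m]_x (f^\- x) by apply: integral_ge0 => x _; exact: funeneg_ge0.
case: (\int[m]_x (f^\- x)) hneg => [r| |]// _ _.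
by case: (\int[m]_x (f^\+ x)) => [s| |]// _; rewrite ltry.
Qed.

End IntegrableMinorant.

(** * Quadratic growth, second moments and a criterion for the convex order *)

Section Integrability.
Context {R : realType} {d : nat}.
Implicit Types (mu nu xi eta : probability 'rV[R]_d R) (phi : 'rV[R]_d -> \bar R).
Local Open Scope ereal_scope.

Lemma measurable_sqn : measurable_fun setT (@sqn R d).
Proof.
rewrite (_ : @sqn R d = (fun y => sqn (0 - y)%R)).
  by apply: measurable_continuous; exact: continuous_sqnB.
by apply/funext => x; rewrite sub0r sqnN.
Qed.

Lemma measurable_cost :
  measurable_fun setT (fun z : 'rV[R]_d * 'rV[R]_d => sqn (z.1 - z.2)).
Proof.
apply: measurable_sum => i; apply: measurable_funX.
rewrite (_ : (fun z : 'rV[R]_d * 'rV[R]_d => _) =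
  (fun z : 'rV[R]_d * 'rV[R]_d => z.1 ord0 i - z.2 ord0 i)%R); last first.
  by apply/funext => z; rewrite !mxE.
apply: measurable_funB.
- exact: (measurableT_comp (measurable_coord i) (@measurable_fst _ _ _ _)).
- exact: (measurableT_comp (measurable_coord i) (@measurable_snd _ _ _ _)).
Qed.

Lemma integrable_sqn mu : P2 mu -> mu.-integrable setT (fun x => (sqn x)%:E).
Proof.
move=> mu2; apply/integrableP; split.
  by apply/measurable_EFinP; exact: measurable_sqn.
by under eq_integral do rewrite gee0_abs ?lee_fin ?sqn_ge0//.
Qed.

Lemma integrable_Sb2 mu (u : 'rV[R]_d -> \bar R) : P2 mu -> Sb2 u ->
  mu.-integrable setT u.
Proof.
move=> mu2 [mf [C hC]].
apply: (@le_integrable _ _ _ _ _ _ _ (fun x => C%:E * (1 + (sqn x)%:E))) => //.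
  by move=> x _; rewrite (le_trans (hC x))// EFinM EFinD lee_abs.
apply: integrableZl => //; apply: integrableD => //; last exact: integrable_sqn.
exact: finite_measure_integrable_cst.
Qed.

Lemma integrable_quad mu (f : 'rV[R]_d -> R) (C : R) : P2 mu ->
  measurable_fun setT f -> (forall x, `|f x| <= C * (1 + sqn x))%R ->
  mu.-integrable setT (EFin \o f).
Proof.
move=> mu2 mf hC; apply: integrable_Sb2 => //; split; first exact/measurable_EFinP.
by exists C => x; rewrite lee_fin.
Qed.

Lemma integrable_coord mu i : P2 mu -> mu.-integrable setT (fun x => (x ord0 i)%:E).
Proof.
move=> mu2; apply: (@integrable_quad _ _ 1) => //; first exact: measurable_coord.
move=> x; rewrite mul1r.
have h : (x ord0 i ^+ 2 <= sqn x)%R.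
  by rewrite /sqn (bigD1 i)//= lerDl sumr_ge0// => j _; exact: sqr_ge0.
by have := sqr_ge0 (`|x ord0 i| - 1)%R; rewrite -(real_normK (num_real (x ord0 i))) in h; nra.
Qed.

Lemma measurable_affine (g b : 'rV[R]_d) (a : R) :
  measurable_fun setT (fun y : 'rV[R]_d => (a + dot g (y - b))%R).
Proof. by apply: measurable_continuous; exact: continuous_affine. Qed.

Lemma measurable_conv_fun (f : 'rV[R]_d -> R) : conv_fun f -> measurable_fun setT f.
Proof. by move=> cf; apply/measurable_EFinP; apply: measurable_lsc; exact: conv_fun_lsc. Qed.

Lemma dotE (g y : 'rV[R]_d) : (dot g y)%:E = \sum_(i < d) (g ord0 i)%:E * (y ord0 i)%:E.
Proof. by rewrite /dot -sumEFin; apply: eq_bigr => i _; rewrite EFinM. Qed.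

Lemma integrable_dot mu g : P2 mu -> mu.-integrable setT (fun y => (dot g y)%:E).
Proof.
move=> mu2; under eq_fun do rewrite dotE.
apply: integrable_sum => // i _; apply: integrableZl => //; exact: integrable_coord.
Qed.

Lemma integral_dot mu g : P2 mu -> \int[mu]_y (dot g y)%:E =
  \sum_(i < d) (g ord0 i)%:E * \int[mu]_y (y ord0 i)%:E.
Proof.
move=> mu2; under eq_integral do rewrite dotE.
rewrite integral_sum//; last first.
  by move=> i; apply: integrableZl => //; exact: integrable_coord.
by apply: eq_bigr => i _; rewrite integralZl//; exact: integrable_coord.
Qed.

(* Subtracting a supporting affine function reduces the convex order to
   nonnegative test functions. *)
Lemma cx_leP mu nu : P2 mu -> P2 nu ->
  (forall i : 'I_d, \int[mu]_x (x ord0 i)%:E = \int[nu]_x (x ord0 i)%:E) ->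
  (forall f : 'rV[R]_d -> R, conv_fun f -> (forall x, 0 <= f x)%R ->
     \int[mu]_x (f x)%:E <= \int[nu]_x (f x)%:E) ->
  cx_le mu nu.
Proof.
move=> mu2 nu2 mean h phi /convex_functionE cphi _ enu.
have [g gP] := subgradient 0 cphi.
pose a y := (phi 0 + dot g y)%R.
have aP y : (a y <= phi y)%R by have := gP y; rewrite subr0.
have mphi := measurable_conv_fun cphi.
have ia m : P2 m -> m.-integrable setT (EFin \o a).
  move=> m2; apply: (@integrableD _ _ _ m _ measurableT (cst (phi 0)%:E)
    (fun y => (dot g y)%:E)); last exact: integrable_dot.
  exact: finite_measure_integrable_cst.
have aE : \int[mu]_x (a x)%:E = \int[nu]_x (a x)%:E.
  rewrite /a; under eq_integral do rewrite EFinD.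
  under [RHS]eq_integral do rewrite EFinD.
  rewrite !integralD//; last 4 first.
  - exact: finite_measure_integrable_cst.
  - exact: integrable_dot.
  - exact: finite_measure_integrable_cst.
  - exact: integrable_dot.
  rewrite !integral_cst_prob !integral_dot//; congr (_ + _).
  by apply: eq_bigr => i _; rewrite mean.
have [nuphi|] := ltP (\int[nu]_x (phi x)%:E) +oo; last first.
  by rewrite leye_eq => /eqP ->; rewrite leey.
have iphi : nu.-integrable setT (EFin \o phi).
  by apply: (integrable_minorant _ (ia _ nu2)) => //; exact/measurable_EFinP.
pose f y := (phi y - a y)%R.
have f0 y : (0 <= f y)%R by rewrite subr_ge0.
have cf : conv_fun f.
  move=> x y t t0 t1; rewrite /f /a dotDr !dotZr; have := cphi x y t t0 t1; lra.
have ifn : nu.-integrable setT (EFin \o f).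
  exact: (integrableB measurableT iphi (ia _ nu2)).
(* Integrability under [mu] is itself a consequence of the comparison [h], applied to the
   nonnegative convex [f]. *)
have ifm : mu.-integrable setT (EFin \o f).
  apply/integrableP; split; first by apply/measurable_EFinP; exact: measurable_conv_fun.
  under eq_integral do rewrite /= ger0_norm//.
  apply: le_lt_trans (h _ cf f0) _; exact: integrable_lty.
have phiE m : P2 m -> m.-integrable setT (EFin \o f) ->
    \int[m]_x (phi x)%:E = \int[m]_x (f x)%:E + \int[m]_x (a x)%:E.
  move=> m2 im; rewrite -integralD//; last exact: ia.
  by apply: eq_integral => x _; rewrite -EFinD subrK.
by rewrite !phiE// aE leeD2r// h.
Qed.

End Integrability.

(** * Weak duality and the equality of the dual values *)

Section WeakDuality.
Context {R : realType} {d : nat}.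
Implicit Types (mu nu xi eta : probability 'rV[R]_d R) (phi : 'rV[R]_d -> \bar R).
Local Open Scope ereal_scope.

Lemma coupling_le mu nu (pi : probability ('rV[R]_d * 'rV[R]_d)%type R)
    (f g : 'rV[R]_d -> \bar R) :
  coupling mu nu pi -> mu.-integrable setT f -> nu.-integrable setT g ->
  (forall x y, f x <= g y + (sqn (x - y))%:E) ->
  \int[mu]_x f x <= \int[nu]_y g y + \int[pi]_z (sqn (z.1 - z.2))%:E.
Proof.
move=> cpl imu inu fg.
have c1 A : measurable A -> pi (fst @^-1` A) = mu A.
  move=> mA; have [<- _] := cpl A mA; congr (pi _).
  by apply/seteqP; split => [[x y]|[x y] []].
have c2 A : measurable A -> pi (snd @^-1` A) = nu A.
  move=> mA; have [_ <-] := cpl A mA; congr (pi _).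
  by apply/seteqP; split => [[x y]|[x y] []].
have gfin : \int[nu]_y g y \is a fin_num by exact: integrable_fin_num.
have [ci|] := ltP (\int[pi]_z (sqn (z.1 - z.2))%:E) +oo; last first.
  by rewrite leye_eq => /eqP ->; rewrite addey ?leey//; move: gfin; rewrite fin_numE => /andP[].
have ic : pi.-integrable setT (fun z => (sqn (z.1 - z.2))%:E).
  apply/integrableP; split; first by apply/measurable_EFinP; exact: measurable_cost.
  by under eq_integral do rewrite gee0_abs ?lee_fin ?sqn_ge0//.
have ig := integrable_same measurable_snd c2 inu.
rewrite -(integral_same measurable_fst c1 (measurable_int _ imu)).
rewrite -(integral_same measurable_snd c2 (measurable_int _ inu)).
rewrite -integralD//; apply: le_integral => //.
- exact: (integrable_same measurable_fst c1 imu).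
- exact: integrableD.
Qed.

Definition scale_fun (a : R) phi := fun y => a%:E * phi y.

Lemma Acx_scale (a : R) phi : (0 < a)%R -> Acx phi -> Acx (scale_fun a phi).
Proof.
move=> a0 [phiNy [y0 fy0] lphi cphi]; rewrite /scale_fun; split.
- move=> x; case: (phi x) (phiNy x) => [r| |] //.
  by rewrite gt0_muley ?lte_fin.
- by exists y0; rewrite fin_numM.
- move=> x b bx; have [|V Vx hV] := lphi x (b / a)%R.
    by rewrite -(lte_pmul2l (_ : a%:E \is a fin_num) (_ : 0 < a%:E))// -EFinM mulrC divfK ?gt_eqF.
  exists V => // y /hV; rewrite -(lte_pmul2l (_ : a%:E \is a fin_num) (_ : 0 < a%:E))//.
  by rewrite -EFinM [(a * _)%R]mulrC divfK ?gt_eqF.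
- move=> x y t t0 t1.
  rewrite (le_trans (lee_wpmul2l _ (cphi x y t t0 t1))) ?lee_fin ?(ltW a0)//.
  rewrite muleDr//; first by rewrite muleCA [X in _ + X]muleCA.
  have t1' : (0 < 1 - t)%R by rewrite subr_gt0.
  by case: (phi x) (phiNy x) => [r| |] // _; case: (phi y) (phiNy y) => [s| |] // _;
    rewrite ?gt0_muley ?lte_fin.
Qed.

(** For [a > 0] this is $\inf_w \{\varphi(w) + a|y - w|^2\}$, the Moreau envelope. It is
    real-valued, so [cx_le] may be tested on it. *)
Definition moreau (a : R) phi (y : 'rV[R]_d) : R :=
  (a * fine (Q2 (scale_fun a^-1 phi) y))%R.

Lemma moreau_conv (a : R) phi : (0 < a)%R -> Acx phi -> conv_fun (moreau a phi).
Proof.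
move=> a0 Aphi x y t t0 t1; have ai0 : (0 < a^-1)%R by rewrite invr_gt0.
have := Q2_conv (Acx_scale ai0 Aphi) x y t0 t1; rewrite /moreau; nra.
Qed.

Lemma moreau_le (a : R) phi y : (0 < a)%R -> Acx phi -> (moreau a phi y)%:E <= phi y.
Proof.
move=> a0 Aphi; have ai0 : (0 < a^-1)%R by rewrite invr_gt0.
rewrite /moreau EFinM fineK; last by apply: Q2_fin_num; exact: Acx_scale.
have := Q2_le (scale_fun a^-1 phi) y y; rewrite /scale_fun subrr sqn0 adde0 => h.
by rewrite (le_trans (lee_wpmul2l _ h)) ?lee_fin ?(ltW a0)// muleA -EFinM divff ?mul1e// gt_eqF.
Qed.

Lemma moreau_Sb2 (a : R) phi : (0 < a)%R -> Acx phi -> Sb2 (EFin \o moreau a phi).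
Proof.
move=> a0 Aphi; have ai0 : (0 < a^-1)%R by rewrite invr_gt0.
have [_ [C hC]] := Q2_Sb2 (Acx_scale ai0 Aphi); split.
  by apply/measurable_EFinP; apply: measurable_conv_fun; exact: moreau_conv.
exists (a * C)%R => x; have := hC x; rewrite lee_fin normrM gtr0_norm// -mulrA.
rewrite -(fineK (Q2_fin_num _ (Acx_scale ai0 Aphi))) lee_fin => h.
by rewrite ler_pM2l.
Qed.

(* Two successive infimal convolutions with weights [a] and [1] amount to one
   with weight [a / (a + 1) = 1 - e]; the right-hand side interpolates between
   the weights [1] and [1 / 2]. *)
Lemma Q2_moreau_ge (e : R) phi x : (0 < e)%R -> (e <= 2^-1)%R -> Acx phi ->
  ((1 - 2 * e) * fine (Q2 phi x) + e * fine (Q2 (scale_fun 2 phi) x))%R%:E <=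
  Q2 (EFin \o moreau ((1 - e) / e) phi) x.
Proof.
move=> e0 e1 Aphi; set a := ((1 - e) / e)%R.
have a0 : (0 < a)%R by rewrite divr_gt0//; lra.
have ai0 : (0 < a^-1)%R by rewrite invr_gt0.
have A2 : Acx (scale_fun 2 phi) by exact: Acx_scale.
apply: le_ereal_inf_tmp => _ [y _ <-] /=.
rewrite -EFinD lee_fin; apply/ler_addgt0Pr => s s0.
have sa0 : (0 < s / a)%R by rewrite divr_gt0.
have [w [r]] := Q2_near y (Acx_scale ai0 Aphi) sa0; rewrite /scale_fun.
case phiw : (phi w) => [p| |]; last 2 first.
- by rewrite gt0_muley ?lte_fin// => -[].
- by rewrite gt0_muleNy ?lte_fin// => -[].
rewrite -EFinM => -[[<-]]; rewrite -(ltr_pM2l a0) !mulrDr mulrA divff ?gt_eqF// mul1r.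
rewrite [(a * (s / a))%R]mulrC divfK ?gt_eqF// -/(moreau _ _ _) => h.
have h1 := Q2_le phi x w; have h2 := Q2_le (scale_fun 2 phi) x w.
rewrite phiw -(fineK (Q2_fin_num _ Aphi)) -EFinD lee_fin in h1.
rewrite /scale_fun phiw -/(scale_fun _ _) -(fineK (Q2_fin_num _ A2)) -EFinM -EFinD lee_fin in h2.
have h3 : ((1 - e) * sqn (x - w) <= a * sqn (y - w) + sqn (x - y))%R.
  rewrite /sqn !mulr_sumr -big_split; apply: ler_sum => i _; rewrite !mxE /=.
  set u := x _ _; set v := y _ _; set z := w _ _.
  rewrite -subr_ge0.
  have -> : (a * (v - z) ^+ 2 + (u - v) ^+ 2 - (1 - e) * (u - z) ^+ 2 =
     e * ((u - v) - a * (v - z)) ^+ 2)%R by rewrite /a; field; rewrite gt_eqF.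
  by rewrite mulr_ge0 ?sqr_ge0// ltW.
(* The weights [1 - 2 * e] and [e] are those for which the two bounds add up to
   [p + (1 - e) * sqn (x - w)]; [e <= 1 / 2] keeps the first one nonnegative. *)
have h1' : ((1 - 2 * e) * fine (Q2 phi x) <= (1 - 2 * e) * (p + sqn (x - w)))%R.
  by rewrite ler_wpM2l//; lra.
have h2' : (e * fine (Q2 (scale_fun 2 phi) x) <= e * (2 * p + sqn (x - w)))%R.
  by rewrite ler_pM2l.
lra.
Qed.

Lemma integral_Q2_fin mu phi : P2 mu -> Acx phi ->
  mu.-integrable setT (EFin \o (fun x => fine (Q2 phi x))).
Proof.
move=> mu2 Aphi; rewrite -Q2_EFin//; apply: integrable_Sb2 => //; exact: Q2_Sb2.
Qed.

(** For each [e] the envelope yields $(1 - 2e) I + e J \le \int\varphi\,d\nu + c$, where $I$ and $J$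
    are finite by quadratic growth. The left side is affine in $e$, so $e \to 0$ needs no limit
    theorem for the envelopes. *)
Lemma weak_duality_down mu nu eta (pi : probability ('rV[R]_d * 'rV[R]_d)%type R) phi :
  P2 mu -> P2 nu -> P2 eta -> cx_le eta nu -> coupling mu eta pi ->
  Acx phi -> nu.-integrable setT phi ->
  \int[mu]_x Q2 phi x - \int[nu]_x phi x <= \int[pi]_z (sqn (z.1 - z.2))%:E.
Proof.
move=> mu2 nu2 eta2 en cpl Aphi iphi.
have fphi : \int[nu]_x phi x \is a fin_num by exact: integrable_fin_num.
rewrite leeBlDr//.
set c := \int[pi]_z _; have c0 : 0 <= c by apply: integral_ge0 => z _; rewrite lee_fin sqn_ge0.
have A2 : Acx (scale_fun 2 phi) by exact: Acx_scale.
have i1 := integral_Q2_fin mu2 Aphi; have i2 := integral_Q2_fin mu2 A2.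
pose I := (\int[mu]_x fine (Q2 phi x))%R.
pose J := (\int[mu]_x fine (Q2 (scale_fun 2 phi) x))%R.
have key (e : R) : (0 < e)%R -> (e <= 2^-1)%R ->
    ((1 - 2 * e) * I + e * J)%R%:E <= \int[nu]_x phi x + c.
  move=> e0 e1; set a := ((1 - e) / e)%R.
  have a0 : (0 < a)%R by rewrite divr_gt0//; lra.
  have Sm := moreau_Sb2 a0 Aphi; have cm := moreau_conv a0 Aphi.
  have iS m : P2 m -> m.-integrable setT (EFin \o moreau a phi).
    by move=> m2; exact: integrable_Sb2.
  have AS := conv_fun_Acx cm.
  have -> : ((1 - 2 * e) * I + e * J)%R%:E =
     \int[mu]_x ((1 - 2 * e) * fine (Q2 phi x) + e * fine (Q2 (scale_fun 2 phi) x))%R%:E.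
    under eq_integral do rewrite EFinD !EFinM.
    rewrite integralD//; [|exact: integrableZl|exact: integrableZl].
    rewrite !integralZl// EFinD !EFinM /I /J /Rintegral !fineK//; exact: integrable_fin_num.
  apply: (@le_trans _ _ (\int[mu]_x Q2 (EFin \o moreau a phi) x)).
    apply: le_integral => //.
    - apply: (integrableD measurableT (integrableZl measurableT _ i1) (integrableZl measurableT _ i2)).
    - by apply: integrable_Sb2 => //; exact: Q2_Sb2.
    - by move=> x _; exact: Q2_moreau_ge.
  apply: le_trans (coupling_le cpl _ (iS _ eta2) (Q2_le _)) _.
    by apply: integrable_Sb2 => //; exact: Q2_Sb2.
  rewrite leeD2r//; apply: (@le_trans _ _ (\int[nu]_x (moreau a phi x)%:E)).
    apply: en; first exact/convex_functionE.
    - by left; exact: (integral_funepos_lt_pinfty measurableT (iS _ eta2)).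
    - by left; exact: (integral_funepos_lt_pinfty measurableT (iS _ nu2)).
  apply: le_integral => //; first exact: iS.
  by move=> x _; exact: moreau_le.
have -> : \int[mu]_x Q2 phi x = I%:E.
  by rewrite Q2_EFin// /I /Rintegral fineK//; exact: integrable_fin_num.
rewrite addeC; case: c c0 key => [c| |]// c0 key; last first.
  by rewrite addey ?leey//; move: fphi; rewrite fin_numE => /andP[].
move: key; rewrite -(fineK fphi) -EFinD lee_fin; set N := fine _ => key.
apply/ler_addgt0Pr => s s0.
(* The deviation from [I] is [e * (2 * I - J)], at most [e * D]; taking [e] below [s / D] bounds it
   by [s], and the added 1 keeps [D] positive. *)
pose D := (`|2 * I - J| + 1)%R.
have D0 : (0 < D)%R by rewrite ltr_wpDl.
pose e := Num.min 2^-1%R (s / D)%R.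
have e0 : (0 < e)%R by rewrite lt_min invr_gt0 ltr0n divr_gt0.
have e1 : (e <= 2^-1)%R by rewrite ge_min lexx.
have := key _ e0 e1; rewrite lee_fin.
have : (e * D <= s)%R by rewrite -ler_pdivlMr// ge_min lexx orbT.
have : (e * (2 * I - J) <= e * D)%R.
  by rewrite ler_pM2l// /D (le_trans (ler_norm _))// lerDl.
nra.
Qed.

Lemma Sb2_fin_num phi x : Sb2 phi -> phi x \is a fin_num.
Proof.
move=> [_ [C hC]]; by rewrite -abse_fin_num ge0_fin_numE ?abse_ge0// (le_lt_trans (hC x)) ?ltry.
Qed.

Lemma integral_Sb2_fin_num mu phi : P2 mu -> Sb2 phi -> \int[mu]_x phi x \is a fin_num.
Proof. by move=> mu2 Sphi; apply: integrable_fin_num => //; exact: integrable_Sb2. Qed.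

Lemma integrable_Qbar2 nu phi : P2 nu -> Acx phi -> Sb2 phi ->
  \int[nu]_y Qbar2 phi y < +oo -> nu.-integrable setT (Qbar2 phi).
Proof.
move=> nu2 Aphi Sphi; apply: (integrable_minorant _ (integrable_Sb2 nu2 Sphi)).
- by apply: measurable_lsc; exact: Qbar2_lsc.
- exact: Qbar2_ge_id.
Qed.

(** [Qbar2 phi] never takes the value [-oo]; finite nowhere, it would be constantly [+oo], which is
    not integrable for a probability. *)
Lemma Acx_Qbar2_integrable nu phi : Acx phi -> nu.-integrable setT (Qbar2 phi) ->
  Acx (Qbar2 phi).
Proof.
move=> Aphi iQ; apply: Qbar2_Acx => //; apply/not_existsP => h.
have QE : Qbar2 phi = cst +oo.
  apply/funext => y; apply/eqP; rewrite -leye_eq leNgt; apply/negP => Qy.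
  apply: (h y); rewrite fin_numElt Qy andbT.
  by apply: lt_le_trans (Qbar2_ge_id phi y); rewrite ltNye; case: Aphi.
have := integrable_fin_num measurableT iQ.
by rewrite QE integral_cst// [X in _ * X](probability_setT nu) mule1.
Qed.

(** The growth condition makes [phi] real-valued, so it tests the convex order directly. When the
    integral of [Qbar2 phi] is [+oo] the left side is [-oo]. *)
Lemma weak_duality_up mu nu xi (pi : probability ('rV[R]_d * 'rV[R]_d)%type R) phi :
  P2 mu -> P2 nu -> P2 xi -> cx_le mu xi -> coupling xi nu pi ->
  Acx phi -> Sb2 phi ->
  \int[mu]_x phi x - \int[nu]_x Qbar2 phi x <= \int[pi]_z (sqn (z.1 - z.2))%:E.
Proof.
move=> mu2 nu2 xi2 mx cpl Aphi Sphi.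
have fphi := integral_Sb2_fin_num mu2 Sphi.
have [Qi|] := ltP (\int[nu]_y Qbar2 phi y) +oo; last first.
  by rewrite leye_eq => /eqP ->; rewrite addeNy leNye.
have iQ := integrable_Qbar2 nu2 Aphi Sphi Qi.
rewrite leeBlDl; last exact: integrable_fin_num.
apply: le_trans (coupling_le cpl (integrable_Sb2 xi2 Sphi) iQ _); last first.
  by move=> x y; rewrite -leeBlDr// Qbar2_ge.
have phiE : phi = EFin \o (fun x => fine (phi x)).
  by apply/funext => x /=; rewrite fineK// Sb2_fin_num.
have iS m : P2 m -> m.-integrable setT phi by move=> m2; exact: integrable_Sb2.
rewrite phiE in Aphi iS *; apply: mx.
- exact/convex_functionE/Acx_conv_fun.
- by left; exact: (integral_funepos_lt_pinfty measurableT (iS _ mu2)).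
- by left; exact: (integral_funepos_lt_pinfty measurableT (iS _ xi2)).
Qed.

Lemma D2_down_le_T2_down mu nu : P2 mu -> P2 nu -> D2_down mu nu <= T2_down mu nu.
Proof.
move=> mu2 nu2; apply: ge_ereal_sup => _ [phi [Aphi iphi] <-].
apply: le_ereal_inf_tmp => _ [eta [eta2 en] <-].
apply: le_ereal_inf_tmp => _ [pi cpl <-].
exact: weak_duality_down cpl Aphi iphi.
Qed.

Lemma D2_up_le_T2_up mu nu : P2 mu -> P2 nu -> D2_up mu nu <= T2_up mu nu.
Proof.
move=> mu2 nu2; apply: ge_ereal_sup => _ [phi [Aphi Sphi] <-].
apply: le_ereal_inf_tmp => _ [xi [xi2 mx] <-].
apply: le_ereal_inf_tmp => _ [pi cpl <-].
exact: weak_duality_up cpl Aphi Sphi.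
Qed.

Lemma T2_lty mu nu : P2 mu -> P2 nu -> T2 mu nu < +oo.
Proof.
move=> mu2 nu2.
pose pi : probability ('rV[R]_d * 'rV[R]_d)%type R := (mu \x nu)%E.
have cpl : coupling mu nu pi.
  move=> A mA; split.
  - by rewrite /pi/= product_measure1E// [X in _ * X](probability_setT nu) mule1.
  - by rewrite /pi/= product_measure1E// [X in X * _](probability_setT mu) mul1e.
apply: (@le_lt_trans _ _ (\int[pi]_z (sqn (z.1 - z.2))%:E)).
  by apply: ereal_inf_lbound; exists pi.
have c1 A : measurable A -> pi (fst @^-1` A) = mu A.
  move=> mA; have [<- _] := cpl A mA; congr (pi _).
  by apply/seteqP; split => [[x y]|[x y] []].
have c2 A : measurable A -> pi (snd @^-1` A) = nu A.
  move=> mA; have [_ <-] := cpl A mA; congr (pi _).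
  by apply/seteqP; split => [[x y]|[x y] []].
have i1 := integrable_same measurable_fst c1 (integrable_sqn mu2).
have i2 := integrable_same measurable_snd c2 (integrable_sqn nu2).
have := integrableD measurableT (integrableZl measurableT 2%R i1)
  (integrableZl measurableT 2%R i2).
move=> /(integrable_lty measurableT); apply: le_lt_trans.
apply: ge0_le_integral => //.
- by move=> z _; rewrite lee_fin sqn_ge0.
- by apply/measurable_EFinP; exact: measurable_cost.
- exact: (measurable_int _ (integrableD measurableT (integrableZl measurableT 2%R i1)
  (integrableZl measurableT 2%R i2))).
- by move=> z _; rewrite -!EFinM -EFinD lee_fin sqnB_le.
Qed.

Lemma T2_down_lty mu nu : P2 mu -> P2 nu -> T2_down mu nu < +oo.
Proof.
move=> mu2 nu2; apply: le_lt_trans (T2_lty mu2 nu2).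
by apply: ereal_inf_lbound; exists nu => //; split => // phi.
Qed.

(** The zero potential gives the lower bound 0; weak duality and the product coupling with
    [eta = nu] give the upper bound. *)
Lemma D2_down_fin_num mu nu : P2 mu -> P2 nu -> D2_down mu nu \is a fin_num.
Proof.
move=> mu2 nu2; rewrite ge0_fin_numE.
  exact: le_lt_trans (D2_down_le_T2_down mu2 nu2) (T2_down_lty mu2 nu2).
have A0 : Acx (fun _ : 'rV[R]_d => 0%:E).
  by apply: (@conv_fun_Acx R d (fun=> 0%R)) => x y t _ _; rewrite !mulr0 addr0.
apply: (@le_trans _ _ (\int[mu]_x Q2 (fun _ => 0%:E) x - \int[nu]_x 0%:E)).
  rewrite integral0 sube0; apply: integral_ge0 => x _.
  by apply: le_ereal_inf_tmp => _ [y _ <-]; rewrite add0e lee_fin sqn_ge0.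
apply: ereal_sup_ubound; exists (fun=> 0%:E) => //; split => //.
exact: integrable0.
Qed.

Lemma Qbar2_dual_value mu nu phi : P2 mu -> P2 nu -> Acx phi -> Sb2 phi ->
  nu.-integrable setT (Qbar2 phi) ->
  \int[mu]_x phi x - \int[nu]_x Qbar2 phi x <=
  \int[mu]_x Q2 (Qbar2 phi) x - \int[nu]_x Qbar2 phi x.
Proof.
move=> mu2 nu2 Aphi Sphi iQ; apply: leeB => //; apply: le_integral => //.
- exact: integrable_Sb2.
- by apply: integrable_Sb2 => //; apply: Q2_Sb2; exact: Acx_Qbar2_integrable iQ.
- by move=> x _; exact: Q2_Qbar2_ge.
Qed.

Lemma Q2_dual_value mu nu phi : P2 nu -> Acx phi -> nu.-integrable setT phi ->
  \int[mu]_x Q2 phi x - \int[nu]_x phi x <=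
  \int[mu]_x Q2 phi x - \int[nu]_x Qbar2 (Q2 phi) x.
Proof.
move=> nu2 Aphi iphi; apply: leeB => //; apply: le_integral => //.
- apply: integrable_Qbar2 => //; [exact: Q2_Acx|exact: Q2_Sb2|].
  (* [Qbar2 (Q2 phi)] lies below [phi], so its positive part is controlled by the integrable
     positive part of [phi]. *)
  apply: (le_lt_trans _ (integral_funepos_lt_pinfty measurableT iphi)).
  rewrite [leLHS]integralE.
  have h2 : 0 <= \int[nu]_x (Qbar2 (Q2 phi))^\- x.
    by apply: integral_ge0 => x _; exact: funeneg_ge0.
  have h1 : \int[nu]_x (Qbar2 (Q2 phi))^\+ x <= \int[nu]_x phi^\+ x.
    apply: ge0_le_integral => //.
    - apply: measurable_funepos; apply: measurable_lsc; apply: Qbar2_lsc; exact: Q2_Acx.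
    - by apply: measurable_funepos; exact: measurable_int iphi.
    - by move=> x _; rewrite !funeposE; apply: le_max2 => //; exact: Qbar2_Q2_le.
  by apply: le_trans (leeB h1 h2) _; rewrite sube0.
- by move=> x _; exact: Qbar2_Q2_le.
Qed.

Lemma D2_down_ub mu nu phi : Acx phi -> nu.-integrable setT phi ->
  \int[mu]_x Q2 phi x - \int[nu]_x phi x <= D2_down mu nu.
Proof. by move=> Aphi iphi; apply: ereal_sup_ubound; exists phi. Qed.

Lemma D2_up_ub mu nu phi : Acx phi -> Sb2 phi ->
  \int[mu]_x phi x - \int[nu]_x Qbar2 phi x <= D2_up mu nu.
Proof. by move=> Aphi Sphi; apply: ereal_sup_ubound; exists phi. Qed.

Lemma D2_up_down mu nu : P2 mu -> P2 nu -> D2_up mu nu = D2_down mu nu.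
Proof.
move=> mu2 nu2; apply/eqP; rewrite eq_le; apply/andP; split.
- apply: ge_ereal_sup => _ [phi [Aphi Sphi] <-].
  have [Qi|] := ltP (\int[nu]_y Qbar2 phi y) +oo; last first.
    rewrite leye_eq => /eqP ->; have := integral_Sb2_fin_num mu2 Sphi.
    by rewrite fin_numElt => /andP[_ _]; rewrite addeNy leNye.
  have iQ := integrable_Qbar2 nu2 Aphi Sphi Qi.
  apply: le_trans (Qbar2_dual_value mu2 nu2 Aphi Sphi iQ) _.
  by apply: D2_down_ub => //; exact: Acx_Qbar2_integrable iQ.
- apply: ge_ereal_sup => _ [phi [Aphi iphi] <-].
  apply: le_trans (Q2_dual_value mu nu2 Aphi iphi) _.
  by apply: D2_up_ub; [exact: Q2_Acx|exact: Q2_Sb2].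
Qed.

(** Since the optimal value is finite, the integral of [Qbar2 phi] cannot be [+oo]. The conjugate
    potential does at least as well in the other dual problem, whose value is the same, so it is
    optimal there. *)
Lemma forward_optimizer mu nu phi : P2 mu -> P2 nu -> Acx phi -> Cb2 phi ->
  \int[mu]_x phi x - \int[nu]_x Qbar2 phi x = D2_up mu nu ->
  [/\ Acx (Qbar2 phi), nu.-integrable setT (Qbar2 phi) &
    \int[mu]_x Q2 (Qbar2 phi) x - \int[nu]_x Qbar2 phi x = D2_down mu nu].
Proof.
move=> mu2 nu2 Aphi [_ bphi] opt.
have Sphi : Sb2 phi by split => //; apply: measurable_lsc; case: Aphi.
have iQ : nu.-integrable setT (Qbar2 phi).
  apply: integrable_Qbar2 => //; rewrite ltNge leye_eq; apply/eqP => QE.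
  have := D2_down_fin_num mu2 nu2; rewrite -D2_up_down// -opt QE.
  by rewrite addeNy.
have AQ := Acx_Qbar2_integrable Aphi iQ; split => //.
apply/eqP; rewrite eq_le D2_down_ub//= -D2_up_down// -opt.
exact: Qbar2_dual_value.
Qed.

Lemma backward_optimizer mu nu phi : P2 mu -> P2 nu -> Acx phi ->
  nu.-integrable setT phi ->
  \int[mu]_x Q2 phi x - \int[nu]_x phi x = D2_down mu nu ->
  [/\ Acx (Q2 phi), Sb2 (Q2 phi) &
    \int[mu]_x Q2 phi x - \int[nu]_x Qbar2 (Q2 phi) x = D2_up mu nu].
Proof.
move=> mu2 nu2 Aphi iphi opt; have AQ := Q2_Acx Aphi; have SQ := Q2_Sb2 Aphi.
split => //; apply/eqP; rewrite eq_le D2_up_ub//= D2_up_down// -opt.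
exact: Q2_dual_value.
Qed.

End WeakDuality.

(** * Measurability of vector-valued and piecewise maps *)

Section MeasurableVector.
Context {R : realType} {d : nat}.

Lemma rat_approx (y : 'rV[R]_d) (r : R) : 0 < r ->
  exists q : 'rV[rat]_d, forall j, `|y ord0 j - ratr (q ord0 j)| < r.
Proof.
move=> r0.
have h j : exists q : rat, `|y ord0 j - ratr q| < r.
  have [q] := @rat_in_itvoo R (y ord0 j - r) (y ord0 j + r) ltac:(lra).
  by rewrite in_itv/= => /andP[h1 h2]; exists q; rewrite ltr_norml; lra.
exists (\row_j xget 0 [set q | `|y ord0 j - ratr q| < r]) => j.
by rewrite mxE; case: xgetP => [q -> //|/= hn]; have [q /hn] := h j.
Qed.

(** The sigma-algebra on row vectors is generated by open sets, and an open set is the countable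
    union of the rational boxes it contains; the preimage of a box is a finite intersection of
    coordinate events. *)
Lemma measurable_rV (dT : measure_display) (T : measurableType dT) (X : T -> 'rV[R]_d) :
  (forall j, measurable_fun setT (fun t => X t ord0 j)) -> measurable_fun setT X.
Proof.
move=> mX.
apply: (measurability (@open 'rV[R]_d)) => // _ [U oU <-]; rewrite setTI.
pose box (c : 'rV[rat]_d * rat) : set 'rV[R]_d :=
  [set y | forall j, `|y ord0 j - ratr (c.1 ord0 j)| < ratr c.2].
have -> : X @^-1` U = \bigcup_(c in [set c | box c `<=` U]) X @^-1` box c.
  apply/seteqP; split => [t /= Ut|t [c /= cU ct]]; last exact: cU.
  have /nbhs_ballP[e /= e0 eU] := open_nbhs_nbhs (conj oU Ut).
  (* Two points of a box of half-width [r] differ by less than [2 * r] in each coordinate, hence the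
     bound [e / 2]. *)
  have [r] := @rat_in_itvoo R 0 (e / 2) ltac:(lra).
  rewrite in_itv/= => /andP[r0 r1].
  have [q qP] := rat_approx (X t) r0.
  exists (q, r) => //= y yq; apply: eU => /=.
  rewrite -ball_normE /ball_/=.
  have [->//|x0] := eqVneq `|X t - y| 0.
  have [[i j] /= xE] := mx_norm_neq0 x0.
  rewrite /Num.norm/= xE ord1 !mxE.
  have -> : X t ord0 j - y ord0 j =
    (X t ord0 j - ratr (q ord0 j)) - (y ord0 j - ratr (q ord0 j)).
    by rewrite opprB addrA subrK.
  apply: le_lt_trans (ler_normB _ _) _.
  by have := qP j; have := yq j => /=; lra.
rewrite bigcup_mkcond; apply: countable_bigcupT_measurable.
  exact: countableP.
move=> c; case: ifPn => // _.
have -> : X @^-1` box c =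
  \bigcap_(j in [set: 'I_d]) ((fun t => X t ord0 j) @^-1`
     [set a | `|a - ratr (c.1 ord0 j)| < ratr c.2]).
  by apply/seteqP; split => [t h j _|t h j]; [exact: h|exact: (h j Logic.I)].
apply: fin_bigcap_measurable => // j _.
rewrite -[_ @^-1` _]setTI; apply: mX => //.
have -> : [set a : R | `|a - ratr (c.1 ord0 j)| < ratr c.2] =
  `](ratr (c.1 ord0 j) - ratr c.2), (ratr (c.1 ord0 j) + ratr c.2)[%classic.
  by apply/seteqP; split => a /=; rewrite in_itv/= ltr_distl.
exact: measurable_itv.
Qed.

Lemma measurable_case (d1 d2 : measure_display) (T1 : measurableType d1)
    (T2 : measurableType d2) (I : finType) (s : T1 -> I) (F : I -> T1 -> T2) :
  (forall i, measurable (s @^-1` [set i])) ->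
  (forall i, measurable_fun setT (F i)) -> measurable_fun setT (fun t => F (s t) t).
Proof.
move=> ms mF _ B mB; rewrite setTI.
have -> : (fun t => F (s t) t) @^-1` B =
  \bigcup_(i in [set: I]) (s @^-1` [set i] `&` F i @^-1` B).
  apply/seteqP; split => [t /= h|t [i _ [/= <- //]]].
  by exists (s t).
apply: fin_bigcup_measurable => // i _; apply: measurableI => //.
by rewrite -[_ @^-1` _]setTI; exact: mF.
Qed.

End MeasurableVector.

Section IntegralLe.
Context d (T : measurableType d) (R : realType) (m : {measure set T -> \bar R}).
Local Open Scope ereal_scope.

(** The positive part of [f] is below [g], and the negative part only lowers the integral, whether
    or not it is finite. *)
Lemma le_integral_ge0 (f g : T -> \bar R) : measurable_fun setT f ->
  measurable_fun setT g -> (forall x, 0 <= g x) -> (forall x, f x <= g x) ->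
  \int[m]_x f x <= \int[m]_x g x.
Proof.
move=> mf mg g0 fg; rewrite [leLHS]integralE.
have h2 : 0 <= \int[m]_x f^\- x by apply: integral_ge0 => x _; exact: funeneg_ge0.
have h1 : \int[m]_x f^\+ x <= \int[m]_x g x.
  apply: ge0_le_integral => //; first exact: measurable_funepos.
  by move=> x _; rewrite funeposE ge_max fg g0.
by apply: le_trans (leeB h1 h2) _; rewrite sube0.
Qed.

End IntegralLe.

(** * Jensen's inequality for a piece of a measure *)

Section Weighted.
Context {R : realType} {d : nat} (nu : probability 'rV[R]_d R) (nu2 : P2 nu).
Implicit Types (q f : 'rV[R]_d -> R).

(** A weight is the density of a piece of a measure with respect to the whole. *)
Definition weight q := measurable_fun setT q /\ forall y, 0 <= q y <= 1.

Lemma integrable_weight q f : weight q -> nu.-integrable setT (EFin \o f) ->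
  nu.-integrable setT (EFin \o (fun y => f y * q y)).
Proof.
move=> [mq q01] intf; apply: (le_integrable _ _ _ intf) => //.
  apply/measurable_EFinP; apply: measurable_funM => //.
  by apply/measurable_EFinP; exact: measurable_int intf.
move=> y _; rewrite /= lee_fin normrM.
have /andP[h0 h1] := q01 y; rewrite [`|q y|]ger0_norm//.
by rewrite -[leRHS]mulr1 ler_wpM2l.
Qed.

Lemma integrable_weight1 q : weight q -> nu.-integrable setT (EFin \o q).
Proof.
move=> wq; have h : nu.-integrable setT (EFin \o cst 1).
  exact: finite_measure_integrable_cst.
have := integrable_weight wq h; apply: eq_integrable => // y _ /=.
by rewrite mul1r.
Qed.

(* The translation by [c - b] moves the barycenter of [q nu] to [c]. *)
Lemma weighted_jensen q f (p : R) (b c : 'rV[R]_d) :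
  weight q -> conv_fun f -> (forall x, 0 <= f x) ->
  \int[nu]_y q y = p -> (forall j, \int[nu]_y (y ord0 j * q y) = p * b ord0 j) ->
  ((p * f c)%:E <= \int[nu]_y (f (y + c - b) * q y)%:E)%E.
Proof.
move=> wq cf f0 pE bE; have [g gP] := subgradient c cf.
have [mq q01] := wq.
(* [G] is [q] times the affine support of [f] at [c], evaluated at [y + c - b] and expanded into
   integrable terms; its first-order part integrates to zero because [b] is the barycenter. *)
pose G y := f c * q y + \sum_(j < d) g ord0 j * (y ord0 j * q y - b ord0 j * q y).
have iq := integrable_weight1 wq.
have iy j : nu.-integrable setT (EFin \o (fun y : 'rV[R]_d => y ord0 j * q y)).
  by apply: integrable_weight => //; exact: integrable_coord.
have iZ (a : R) (k : 'rV[R]_d -> R) : nu.-integrable setT (EFin \o k) ->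
   nu.-integrable setT (EFin \o (fun y => a * k y)).
  by move=> ik; have := integrableZl measurableT a ik; apply: eq_integrable.
have iB j : nu.-integrable setT (EFin \o (fun y : 'rV[R]_d => y ord0 j * q y - b ord0 j * q y)).
  by have := integrableB measurableT (iy j) (iZ (b ord0 j) _ iq); apply: eq_integrable.
have GE : (\int[nu]_y (G y)%:E = (p * f c)%:E)%E.
  have -> : (\int[nu]_y (G y)%:E = \int[nu]_y ((f c * q y)%:E +
     \sum_(j < d) (g ord0 j * (y ord0 j * q y - b ord0 j * q y))%:E))%E.
    by apply: eq_integral => y _; rewrite sumEFin -EFinD.
  rewrite integralD//; last 2 first.
  - exact: iZ.
  - by apply: integrable_sum => // j _; apply: iZ.
  rewrite integral_sum//; last by move=> j; apply: iZ.
  have EI (k : 'rV[R]_d -> R) : nu.-integrable setT (EFin \o k) ->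
     (\int[nu]_y (k y)%:E = (\int[nu]_y k y)%R%:E)%E.
    by move=> ik; rewrite /Rintegral fineK//; exact: integrable_fin_num.
  rewrite EI; last exact: iZ.
  rewrite RintegralZl// pE [X in (_ + X)%E]big1 ?adde0 1?mulrC// => j _.
  rewrite EI; last exact: iZ.
  rewrite RintegralZl// RintegralB//; last exact: iZ.
  by rewrite bE RintegralZl// pE [p * _]mulrC subrr mulr0.
rewrite -GE; apply: le_integral_ge0.
- apply/measurable_EFinP; apply: measurable_funD; first exact: measurable_funM.
  apply: measurable_sum => j; apply: measurable_funM => //.
  by apply: measurable_funB; apply: measurable_funM => //; exact: measurable_coord.
- apply/measurable_EFinP; apply: measurable_funM => //.
  apply: (measurableT_comp (measurable_conv_fun cf)).
  apply: measurable_rV => j.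
  rewrite (_ : (fun t => _) = (fun y : 'rV[R]_d => y ord0 j + (c ord0 j - b ord0 j))).
    by apply: measurable_funD => //; exact: measurable_coord.
  by apply/funext => y; rewrite !mxE addrA.
- by move=> y; rewrite lee_fin mulr_ge0//; case/andP: (q01 y).
- move=> y; rewrite lee_fin /G.
  have -> : f c * q y + \sum_(j < d) g ord0 j * (y ord0 j * q y - b ord0 j * q y) =
     (f c + dot g (y + c - b - c)) * q y.
    rewrite mulrDl /dot mulr_suml; congr (_ + _); apply: eq_bigr => j _.
    by rewrite !mxE; ring.
  by rewrite ler_wpM2r//; case/andP: (q01 y).
Qed.

End Weighted.

(** * Competitors built from a splitting of the target measure *)

Section SemiDiscrete.
Context {R : realType} {d : nat} (mu nu : probability 'rV[R]_d R).
Hypotheses (mu2 : P2 mu) (nu2 : P2 nu).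
Variables (I : finType) (s : 'rV[R]_d -> I) (q : I -> 'rV[R]_d -> R).
Variables (p : I -> R) (b : I -> 'rV[R]_d).
Hypotheses (ms : forall i, measurable (s @^-1` [set i]))
  (wq : forall i, weight (q i)) (q1 : forall y, \sum_i q i y = 1)
  (p0 : forall i, 0 < p i) (pmu : forall i, mu (s @^-1` [set i]) = (p i)%:E)
  (pq : forall i, \int[nu]_y q i y = p i)
  (bE : forall i j, \int[nu]_y (y ord0 j * q i y) = p i * b i ord0 j).

Let q0 i y : 0 <= q i y. Proof. by case: (wq i) => _ /(_ y)/andP[]. Qed.

Let mq i : measurable_fun setT (q i). Proof. by case: (wq i). Qed.

Let mB : measurable_fun setT (fun x => b (s x)).
Proof. by apply: (measurable_case (F := fun i _ => b i)). Qed.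

Let pqE i : (\int[nu]_y (q i y)%:E = (p i)%:E)%E.
Proof.
rewrite -pq /Rintegral fineK//; apply: integrable_fin_num => //.
exact: integrable_weight1.
Qed.

Lemma integral_cells (g : I -> R) :
  (\int[mu]_x (g (s x))%:E = (\sum_i p i * g i)%:E)%E.
Proof.
have -> : (\int[mu]_x (g (s x))%:E =
   \int[mu]_x (\sum_i (g i)%:E * (\1_(s @^-1` [set i]) x)%:E))%E.
  apply: eq_integral => x _; rewrite (bigD1 (s x))//= indicE mem_set// mule1.
  rewrite big1 ?adde0// => i isx; rewrite indicE memNset ?mule0//= => /esym/eqP.
  exact/negP.
rewrite integral_sum//; last first.
  by move=> i; apply: integrableZl => //; exact: integrable_indic.
rewrite -sumEFin; apply: eq_bigr => i _; rewrite integralZl//; last exact: integrable_indic.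
by rewrite integral_indic// setIT [X in (_ * X)%E]pmu -EFinM mulrC.
Qed.

Lemma bary_mean j : (\sum_i p i * b i ord0 j)%:E = (\int[nu]_y (y ord0 j)%:E)%E.
Proof.
have iy i : nu.-integrable setT (EFin \o (fun y : 'rV[R]_d => y ord0 j * q i y)).
  by apply: integrable_weight => //; exact: integrable_coord.
transitivity (\sum_i \int[nu]_y (y ord0 j * q i y)%:E)%E.
  rewrite -sumEFin; apply: eq_bigr => i _; rewrite -bE /Rintegral fineK//.
  exact: (integrable_fin_num measurableT (iy i)).
rewrite -integral_sum//; apply: eq_integral => y _.
by rewrite sumEFin -mulr_sumr q1 mulr1.
Qed.

Let quad_cells (g : I -> R) (x : 'rV[R]_d) :
  `|g (s x)| <= (\sum_i `|g i|) * (1 + sqn x).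
Proof.
rewrite mulrDr mulr1 (bigD1 (s x))//= -addrA lerDl addr_ge0 ?sumr_ge0//.
by rewrite mulr_ge0 ?sqn_ge0// addr_ge0 ?sumr_ge0.
Qed.

Let measurable_cells (g : I -> R) : measurable_fun setT (fun x => g (s x)).
Proof. by apply: (measurable_case (F := fun i _ => g i)). Qed.

Lemma integrable_cells (g : I -> R) : mu.-integrable setT (EFin \o (fun x => g (s x))).
Proof.
by apply: (integrable_quad mu2 (measurable_cells g)) => x; exact: quad_cells.
Qed.

Let eta : probability 'rV[R]_d R := law mu mB.

Let eta2 : P2 eta.
Proof.
rewrite /P2 (ge0_integral_law mu mB); first exact: integrable_lty (integrable_cells (fun i => sqn (b i))).
- by apply/measurable_EFinP; exact: measurable_sqn.
- by move=> y; rewrite lee_fin sqn_ge0.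
Qed.

Let etaE (g : 'rV[R]_d -> R) : measurable_fun setT g ->
  (\int[eta]_y (g y)%:E = (\sum_i p i * g (b i))%:E)%E.
Proof.
move=> mg; rewrite -(@integral_same _ _ _ _ _ mu eta _ mB _ (EFin \o g))//.
- exact: (integral_cells (fun i => g (b i))).
- exact/measurable_EFinP.
Qed.

(** Jensen's inequality on each piece, with [c = b i] so that the translation disappears, summed
    using $\sum_i q_i = 1$. *)
Let eta_cx : cx_le eta nu.
Proof.
apply: cx_leP => //.
- by move=> j; rewrite (etaE (@measurable_coord R d j)) bary_mean.
- move=> f cf f0; have mf := measurable_conv_fun cf; rewrite etaE//.
  have -> : (\int[nu]_y (f y)%:E = \int[nu]_y \sum_i (f y * q i y)%:E)%E.
    by apply: eq_integral => y _; rewrite sumEFin -mulr_sumr q1 mulr1.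
  rewrite ge0_integral_sum//; last 2 first.
  - by move=> i; apply/measurable_EFinP; exact: measurable_funM.
  - by move=> i y _; rewrite lee_fin mulr_ge0.
  rewrite -sumEFin; apply: lee_sum => i _.
  apply: le_trans (weighted_jensen nu2 (b i) (wq i) cf f0 (pq i) (bE i)) _.
  apply: le_integral_ge0 => // [|||y].
  - apply/measurable_EFinP; apply: measurable_funM => //.
    by under eq_fun do rewrite addrK.
  - by apply/measurable_EFinP; apply: measurable_funM.
  - by move=> y; rewrite lee_fin mulr_ge0.
  - by rewrite addrK.
Qed.

Lemma T2_down_le : (T2_down mu nu <= \int[mu]_x (sqn (x - b (s x)))%:E)%E.
Proof.
have mP : measurable_fun setT (fun x => (x, b (s x))).
  by apply: measurable_fun_pair => //; exact: mB.
have -> : (\int[mu]_x (sqn (x - b (s x)))%:E = \int[law mu mP]_z (sqn (z.1 - z.2))%:E)%E.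
  rewrite ge0_integral_law//; last by move=> z; rewrite lee_fin sqn_ge0.
  by apply/measurable_EFinP; exact: measurable_cost.
apply: (@le_trans _ _ (T2 mu eta)); first by apply: ereal_inf_lbound; exists eta.
apply: ereal_inf_lbound; exists (law mu mP) => //= A mA; split.
- transitivity (mu ((fun x => (x, b (s x))) @^-1` (A `*` setT))) => //.
  by congr (mu _); apply/seteqP; split => [x []|x] //=.
- transitivity (mu ((fun x => (x, b (s x))) @^-1` (setT `*` A))) => //.
  transitivity (mu ((fun x => b (s x)) @^-1` A)) => //.
  by congr (mu _); apply/seteqP; split => [x []|x] //=.
Qed.

(** Density with respect to [mu \x nu] of the pair $(X, Y)$: given $X = x$, the point $Y$ follows
    the normalized piece of the cell of $x$. Normalization of the pieces gives the first marginal
    [mu]; the cell masses cancel the divisors [p i], which gives the second marginal [nu]. *)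
Let h (z : 'rV[R]_d * 'rV[R]_d) : R := q (s z.1) z.2 / p (s z.1).

Let mh : measurable_fun setT h.
Proof.
apply: (@measurable_case _ _ _ _ I (fun z : 'rV[R]_d * 'rV[R]_d => s z.1)
  (fun i (z : 'rV[R]_d * 'rV[R]_d) => q i z.2 / p i)) => i.
- have := @measurable_fst _ _ 'rV[R]_d 'rV[R]_d measurableT _ (ms i).
  by rewrite setTI.
- apply: measurable_funM => //.
  exact: (measurableT_comp (mq i) (@measurable_snd _ _ _ _)).
Qed.

Let h0 z : 0 <= h z.
Proof. by rewrite /h divr_ge0// ltW. Qed.

Let hx x : (\int[nu]_y (h (x, y))%:E = 1)%E.
Proof.
rewrite /h/=; under eq_integral do rewrite EFinM.
rewrite ge0_integralZr//; last 3 first.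
- by apply/measurable_EFinP; exact: mq.
- by move=> y _; rewrite lee_fin.
- by rewrite lee_fin invr_ge0 ltW.
by rewrite pqE -EFinM divff// gt_eqF.
Qed.

Let hy y : (\int[mu]_x (h (x, y))%:E = 1)%E.
Proof.
rewrite /h/= (integral_cells (fun i => q i y / p i)).
congr (_%:E); rewrite -(q1 y); apply: eq_bigr => i _.
by rewrite mulrCA divff ?mulr1// gt_eqF.
Qed.

Let h1 : (\int[(mu \x nu)%E]_z (h z)%:E = 1)%E.
Proof.
rewrite fubini_tonelli1//; last exact/measurable_EFinP.
rewrite /fubini_F; under eq_integral do rewrite hx.
exact: integral_cst_prob.
Qed.

Let pi0 : probability ('rV[R]_d * 'rV[R]_d)%type R := densityP mh h0 h1.

Let pi0E (f : 'rV[R]_d * 'rV[R]_d -> \bar R) : measurable_fun setT f ->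
  (forall z, 0 <= f z)%E ->
  (\int[pi0]_z f z = \int[mu]_x \int[nu]_y (f (x, y) * (h (x, y))%:E))%E.
Proof.
move=> mf f0; rewrite [LHS](@ge0_integral_density _ _ _ (mu \x nu)%E h mh h0 f mf f0) fubini_tonelli1//.
- by apply: emeasurable_funM => //; exact/measurable_EFinP.
- by move=> z; rewrite mule_ge0// lee_fin.
Qed.

Let pi0E' (f : 'rV[R]_d * 'rV[R]_d -> \bar R) : measurable_fun setT f ->
  (forall z, 0 <= f z)%E ->
  (\int[pi0]_z f z = \int[nu]_y \int[mu]_x (f (x, y) * (h (x, y))%:E))%E.
Proof.
move=> mf f0; rewrite [LHS](@ge0_integral_density _ _ _ (mu \x nu)%E h mh h0 f mf f0) fubini_tonelli2//.
- by apply: emeasurable_funM => //; exact/measurable_EFinP.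
- by move=> z; rewrite mule_ge0// lee_fin.
Qed.

Let pi0_fst A : measurable A -> pi0 (fst @^-1` A) = mu A.
Proof.
move=> mA.
have mA' : measurable (fst @^-1` A : set ('rV[R]_d * 'rV[R]_d)).
  by have := @measurable_fst _ _ 'rV[R]_d 'rV[R]_d measurableT _ mA; rewrite setTI.
have -> : pi0 (fst @^-1` A) = (\int[pi0]_z (\1_A z.1)%:E)%E.
  by rewrite (integral_indic pi0 measurableT mA') setIT.
rewrite pi0E; last 2 first.
- apply/measurable_EFinP; apply: (measurableT_comp _ (@measurable_fst _ _ _ _)).
  exact: measurable_indic.
- by move=> z; rewrite lee_fin.
rewrite -[in RHS](setIT A) -integral_indic//; apply: eq_integral => x _ /=.
rewrite ge0_integralZl//; first by rewrite hx mule1.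
- by apply/measurable_EFinP; exact: (measurableT_comp mh (measurable_pair1 _)).
- by move=> y _; rewrite lee_fin.
Qed.

Let pi0_snd A : measurable A -> pi0 (snd @^-1` A) = nu A.
Proof.
move=> mA.
have mA' : measurable (snd @^-1` A : set ('rV[R]_d * 'rV[R]_d)).
  by have := @measurable_snd _ _ 'rV[R]_d 'rV[R]_d measurableT _ mA; rewrite setTI.
have -> : pi0 (snd @^-1` A) = (\int[pi0]_z (\1_A z.2)%:E)%E.
  by rewrite (integral_indic pi0 measurableT mA') setIT.
rewrite pi0E'; last 2 first.
- apply/measurable_EFinP; apply: (measurableT_comp _ (@measurable_snd _ _ _ _)).
  exact: measurable_indic.
- by move=> z; rewrite lee_fin.
rewrite -[in RHS](setIT A) -integral_indic//; apply: eq_integral => y _ /=.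
rewrite ge0_integralZl//; first by rewrite hy mule1.
- by apply/measurable_EFinP; exact: (measurableT_comp mh (measurable_pair2 _)).
- by move=> x _; rewrite lee_fin.
Qed.

Let X' (z : 'rV[R]_d * 'rV[R]_d) : 'rV[R]_d := z.2 + z.1 - b (s z.1).

Let mX' : measurable_fun setT X'.
Proof.
apply: measurable_rV => j.
rewrite (_ : (fun t => _) = (fun z : 'rV[R]_d * 'rV[R]_d =>
   z.2 ord0 j + z.1 ord0 j - b (s z.1) ord0 j)); last by apply/funext => z; rewrite !mxE.
have mc := @measurable_coord R d j.
apply: measurable_funB; first apply: measurable_funD.
- exact: (measurableT_comp mc (@measurable_snd _ _ _ _)).
- exact: (measurableT_comp mc (@measurable_fst _ _ _ _)).
- exact: (measurableT_comp (measurableT_comp mc mB) (@measurable_fst _ _ _ _)).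
Qed.

Let xi : probability 'rV[R]_d R := law pi0 mX'.

Let ifst (f : 'rV[R]_d -> \bar R) : mu.-integrable setT f ->
  pi0.-integrable setT (fun z => f z.1).
Proof. exact: (integrable_same (@measurable_fst _ _ _ _) pi0_fst). Qed.

Let isnd (f : 'rV[R]_d -> \bar R) : nu.-integrable setT f ->
  pi0.-integrable setT (fun z => f z.2).
Proof. exact: (integrable_same (@measurable_snd _ _ _ _) pi0_snd). Qed.

Let xi2 : P2 xi.
Proof.
rewrite /P2 (ge0_integral_law pi0 mX'); last 2 first.
- by apply/measurable_EFinP; exact: measurable_sqn.
- by move=> y; rewrite lee_fin sqn_ge0.
have i1 := isnd (integrableZl measurableT 2 (integrable_sqn nu2)).
have i2 := ifst (integrableZl measurableT 4 (integrable_sqn mu2)).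
have i3 := ifst (integrableZl measurableT 4 (integrable_cells (fun i => sqn (b i)))).
have i123 := integrableD measurableT i1 (integrableD measurableT i2 i3).
apply: le_lt_trans (integrable_lty measurableT i123).
apply: le_integral_ge0.
- by apply/measurable_EFinP; exact: (measurableT_comp measurable_sqn mX').
- exact: measurable_int i123.
- move=> z; rewrite /= -!EFinM -!EFinD lee_fin.
  by rewrite !addr_ge0// mulr_ge0// sqn_ge0.
- move=> z; rewrite /= -!EFinM -!EFinD lee_fin /X' -addrA.
  by have := sqnD_le z.2 (z.1 - b (s z.1)); have := sqnB_le z.1 (b (s z.1)); lra.
Qed.

(** Given $X = x$, the variable $Y + x - b(s\,x)$ has mean $x$, so Jensen's inequality bounds [f x]
    by its conditional expectation of [f]; integrating over [mu] concludes. *)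
Let xi_cx : cx_le mu xi.
Proof.
apply: cx_leP => //.
- move=> j; have mc := @measurable_coord R d j.
  rewrite -(@integral_same _ _ _ _ _ pi0 xi _ mX' _ (fun x => (x ord0 j)%:E))//; last exact/measurable_EFinP.
  have i1 := isnd (integrable_coord j nu2).
  have i2 := ifst (integrable_coord j mu2).
  have i3 := ifst (integrable_cells (fun i => b i ord0 j)).
  have -> : (\int[pi0]_z (X' z ord0 j)%:E = \int[pi0]_z (((z.2 ord0 j)%:E + (z.1 ord0 j)%:E) - (b (s z.1) ord0 j)%:E))%E.
    by apply: eq_integral => z _; rewrite !mxE EFinB EFinD.
  rewrite integralB//; last exact: integrableD.
  rewrite integralD//.
  rewrite (integral_same (@measurable_snd _ _ _ _) pi0_snd (f := fun y => (y ord0 j)%:E)); last exact/measurable_EFinP.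
  rewrite (integral_same (@measurable_fst _ _ _ _) pi0_fst (f := fun y => (y ord0 j)%:E)); last exact/measurable_EFinP.
  rewrite (integral_same (@measurable_fst _ _ _ _) pi0_fst (f := fun y => (b (s y) ord0 j)%:E)); last first.
    by apply/measurable_EFinP; exact: (measurable_cells (fun i => b i ord0 j)).
  rewrite (integral_cells (fun i => b i ord0 j)) bary_mean addeAC subee ?add0e//.
  by rewrite -bary_mean.
- move=> f cf f0; have mf := measurable_conv_fun cf.
  rewrite (ge0_integral_law pi0 mX'); last 2 first.
  - exact/measurable_EFinP.
  - by move=> y; rewrite lee_fin.
  have mfX : measurable_fun setT (fun z => f (X' z)) by exact: (measurableT_comp mf mX').
  rewrite (pi0E (f := fun z => (f (X' z))%:E)); last 2 first.
  - exact/measurable_EFinP.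
  - by move=> z; rewrite lee_fin.
  have mG : measurable_fun setT (fun z => (f (X' z))%:E * (h z)%:E)%E.
    by apply: emeasurable_funM; exact/measurable_EFinP.
  apply: le_integral_ge0.
  - exact/measurable_EFinP.
  - apply: (measurable_fun_fubini_tonelli_F (fun z => (f (X' z))%:E * (h z)%:E)%E) => // z.
    by rewrite mule_ge0// lee_fin.
  - by move=> x; apply: integral_ge0 => y _; rewrite mule_ge0// lee_fin.
  (* Multiplying by the mass [p (s x)] undoes the normalization in [h] and gives the form of
     [weighted_jensen] with [c = x]. *)
  - move=> x; rewrite -(@lee_pmul2l _ (p (s x))%:E)//; last by rewrite lte_fin.
    rewrite -EFinM; apply: le_trans (weighted_jensen nu2 x (wq (s x)) cf f0 (pq _) (bE _)) _.
    rewrite -ge0_integralZl//; last 3 first.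
    - by apply: (measurableT_comp mG (measurable_pair1 _)).
    - by move=> y _; rewrite mule_ge0// lee_fin.
    - by rewrite lee_fin ltW.
    rewrite le_eqVlt; apply/orP; left; apply/eqP; apply: eq_integral => y _.
    rewrite -!EFinM /X' /h /=; congr (_%:E).
    by field; rewrite gt_eqF.
Qed.

(** Couple $X' = Y + X - b(s\,X)$ with $Y$ itself: the displacement $X' - Y = X - b(s\,X)$ depends
    on $X$ alone. *)
Lemma T2_up_le : (T2_up mu nu <= \int[mu]_x (sqn (x - b (s x)))%:E)%E.
Proof.
have mP : measurable_fun setT (fun z : 'rV[R]_d * 'rV[R]_d => (X' z, z.2)).
  by apply: measurable_fun_pair => //; exact: mX'.
have -> : (\int[mu]_x (sqn (x - b (s x)))%:E = \int[law pi0 mP]_z (sqn (z.1 - z.2))%:E)%E.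
  rewrite ge0_integral_law; last 2 first.
  - by apply/measurable_EFinP; exact: measurable_cost.
  - by move=> z; rewrite lee_fin sqn_ge0.
  rewrite -(ge0_integral_same (@measurable_fst _ _ _ _) pi0_fst (f := fun x => (sqn (x - b (s x)))%:E)).
  - by apply: eq_integral => z _ /=; rewrite /X' -[z.2 + _ - _]addrA [z.2 + _]addrC addrK.
  - apply/measurable_EFinP; apply: (measurableT_comp measurable_sqn).
    apply: measurable_rV => j.
    rewrite (_ : (fun t => _) = (fun x : 'rV[R]_d => x ord0 j - b (s x) ord0 j)); last first.
      by apply/funext => z; rewrite !mxE.
    apply: measurable_funB; first exact: measurable_coord.
    exact: (measurable_cells (fun i => b i ord0 j)).
  - by move=> x; rewrite lee_fin sqn_ge0.
apply: (@le_trans _ _ (T2 xi nu)); first by apply: ereal_inf_lbound; exists xi.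
apply: ereal_inf_lbound; exists (law pi0 mP) => //= A mA; split.
- transitivity (pi0 ((fun z => (X' z, z.2)) @^-1` (A `*` setT))) => //.
  transitivity (pi0 (X' @^-1` A)) => //.
  by congr (pi0 _); apply/seteqP; split => [x []|x] //=.
- transitivity (pi0 ((fun z => (X' z, z.2)) @^-1` (setT `*` A))) => //.
  rewrite -pi0_snd//.
  by congr (pi0 _); apply/seteqP; split => [x []|x] //=.
Qed.

End SemiDiscrete.

(** * Near-projections, selections and fine partitions *)

Section ApproximateProjection.
Context {R : realType} (J : finType) (B : set (J -> R)) (w a : J -> R) (D : R).
Hypotheses (w0 : forall j, 0 <= w j) (B0 : B !=set0)
  (cB : forall u v t, B u -> B v -> 0 <= t -> t <= 1 ->
     B (fun j => (1 - t) * u j + t * v j))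
  (bB : forall v j, B v -> `|v j| <= D).

(* [u] is a near-projection of [a] onto the convex set [B] for the weighted
   Euclidean distance; the bound is its approximate variational inequality. *)
Lemma approx_projection (e : R) : 0 < e ->
  exists2 u, B u & forall v, B v -> \sum_j w j * (a j - u j) * (v j - u j) <= e.
Proof.
move=> e0; pose Phi v := \sum_j w j * (v j - a j) ^+ 2.
have Phi0 v : 0 <= Phi v by apply: sumr_ge0 => j _; rewrite mulr_ge0// sqr_ge0.
pose C := \sum_j w j * (2 * D) ^+ 2.
have C0 : 0 <= C by apply: sumr_ge0 => j _; rewrite mulr_ge0// sqr_ge0.
have CP u v : B u -> B v -> \sum_j w j * (v j - u j) ^+ 2 <= C.
  move=> Bu Bv; apply: ler_sum => j _; rewrite ler_wpM2l//.
  have := bB j Bu; have := bB j Bv; rewrite !ler_norml; nra.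
(* A step of length [t] towards [v] changes the quadratic remainder by at most [t ^+ 2 * C], hence
   by at most [t * e], as [C] bounds the squared weighted diameter. *)
pose t := Num.min 1 (e / (C + 1)).
have C1 : 0 < C + 1 by lra.
have t0 : 0 < t by rewrite lt_min ltr01 divr_gt0.
have t1 : t <= 1 by rewrite ge_min lexx.
have tC : t * C <= e.
  have : t * (C + 1) <= e by rewrite -ler_pdivlMr// ge_min lexx orbT.
  nra.
pose S := [set Phi v | v in B].
have infS : has_inf S.
  by split; [case: B0 => v Bv; exists (Phi v), v|exists 0 => _ [v _ <-]].
(* The tolerance [t * e] is scaled by the step length, so that dividing by [t] at the end leaves
   [2 * X <= 2 * e]. *)
have [_ [u Bu <-] uS] := inf_adherent (mulr_gt0 t0 e0) infS.
exists u => // v Bv.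
have : inf S <= Phi (fun j => (1 - t) * u j + t * v j).
  by apply: ge_inf; [case: infS|exists (fun j => (1 - t) * u j + t * v j) => //; apply: cB => //; exact: ltW].
have -> : Phi (fun j => (1 - t) * u j + t * v j) =
  Phi u - 2 * t * (\sum_j w j * (a j - u j) * (v j - u j)) +
  t ^+ 2 * \sum_j w j * (v j - u j) ^+ 2.
  rewrite /Phi !mulr_sumr -sumrB -big_split; apply: eq_bigr => j _ /=; ring.
move=> h; have := CP u v Bu Bv.
set X := \sum_j _ in h *; set Y := \sum_j _ in h * => hY.
have h2 : 2 * t * X <= t * e + t ^+ 2 * Y by lra.
have : t ^+ 2 * Y <= t * e.
  rewrite expr2 -mulrA ler_pM2l//; apply: le_trans tC; rewrite ler_pM2l//.
move=> h3; rewrite -(ler_pM2l t0); lra.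
Qed.

End ApproximateProjection.

Section Selection.
Context d (T : measurableType d) {R : realType} (I : finType) (i0 : I).
Variables (f : I -> T -> R) (mf : forall i, measurable_fun setT (f i)).

Let pat (t : T) : {ffun I * I -> bool} := [ffun ij => f ij.1 t <= f ij.2 t].

(** The choice depends on [t] only through the finite table [pat] of comparisons, so every fibre is
    a finite union of measurable events. The default [i0] is never reached, as a finite family has a
    maximum. *)
Definition argmax_sel (t : T) : I :=
  odflt i0 [pick i | [forall j, pat t (j, i)]].

Lemma argmax_selP t i : f i t <= f (argmax_sel t) t.
Proof.
rewrite /argmax_sel; case: pickP => [k /forallP/(_ i)|h] /=; first by rewrite ffunE.
have [k _ kP] := @Order.TotalTheory.arg_maxP _ _ I i0 xpredT (f ^~ t) isT.
by have := h k; move/negbT/negP; elim; apply/forallP => j; rewrite ffunE; exact: kP.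
Qed.

Lemma measurable_argmax_sel i : measurable (argmax_sel @^-1` [set i]).
Proof.
have -> : argmax_sel @^-1` [set i] = \bigcup_(M in [set M : {ffun I * I -> bool} |
    odflt i0 [pick i | [forall j, M (j, i)]] = i]) (pat @^-1` [set M]).
  by apply/seteqP; split => [t /= h|t [M /= Mi tM]]; [exists (pat t)|rewrite /= /argmax_sel tM].
apply: fin_bigcup_measurable => // M _.
have -> : pat @^-1` [set M] = \bigcap_(ij in [set: I * I])
    ((fun t => f ij.1 t <= f ij.2 t) @^-1` [set M ij]).
  apply/seteqP; split => [t /= <- ij _ /=|t h]; first by rewrite ffunE.
  by apply/ffunP => ij; rewrite ffunE; exact: (h ij Logic.I).
apply: fin_bigcap_measurable => // ij _.
rewrite -[_ @^-1` _]setTI; have := measurable_fun_ler (mf ij.1) (mf ij.2).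
by apply.
Qed.

End Selection.

Section Partition.
Context {R : realType} {d : nat} (mu : probability 'rV[R]_d R) (mu2 : P2 mu).

(** Enumeration of the rational points shifted by one, so that the origin has index 0 and competes
    in every [near n]; codes of no vector also yield the origin. *)
Let a (k : nat) : 'rV[R]_d :=
  if k is k'.+1 then map_mx ratr (odflt 0 (unpickle k' : option 'rV[rat]_d)) else 0.

Let a_dense (x : 'rV[R]_d) (e : R) : 0 < e -> exists k, sqn (x - a k) < e.
Proof.
(* With [0 < r <= 1] and [r * (d + 1) <= e] one has [d * r ^+ 2 < e]. *)
move=> e0; pose r := Num.min 1 (e / (d%:R + 1)).
have d1 : 0 < d%:R + 1 :> R by rewrite ltr_wpDl.
have r0 : 0 < r by rewrite lt_min ltr01 divr_gt0.
have r1 : r <= 1 by rewrite ge_min lexx.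
have [q qP] := rat_approx x r0.
exists (pickle q).+1; rewrite /= pickleK/=.
have : r * (d%:R + 1) <= e by rewrite -ler_pdivlMr// ge_min lexx orbT.
have : sqn (x - map_mx ratr q) <= \sum_(j < d) r ^+ 2.
  apply: ler_sum => j _; rewrite !mxE -real_normK ?num_real//.
  by rewrite ler_sqr ?nnegrE ?(ltW r0)//; exact/ltW/qP.
rewrite sumr_const card_ord -mulr_natl.
have : 0 <= d%:R :> R by [].
set D := d%:R; nra.
Qed.

Let near (n : nat) := argmax_sel (ord0 : 'I_n.+1) (fun (i : 'I_n.+1) (x : 'rV[R]_d) => - sqn (a i - x)).

Let mnear n i : measurable (near n @^-1` [set i]).
Proof.
apply: measurable_argmax_sel => j; apply: measurable_funN.
by apply: measurable_continuous; exact: continuous_sqnB.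
Qed.

Let nearP n x k : (k <= n)%N -> sqn (x - a (near n x)) <= sqn (x - a k).
Proof.
move=> kn; rewrite sqnB [leRHS]sqnB -lerN2.
exact: (@argmax_selP _ 'rV[R]_d R 'I_n.+1 ord0 (fun i (x : 'rV[R]_d) => - sqn (a i - x)) x (Ordinal (kn : k < n.+1)%N)).
Qed.

Lemma measurable_fun_cost (I : finType) (s : 'rV[R]_d -> I) (c : I -> 'rV[R]_d) :
  (forall i, measurable (s @^-1` [set i])) ->
  measurable_fun setT (fun x : 'rV[R]_d => (sqn (x - c (s x)))%:E).
Proof.
move=> ms; apply/measurable_EFinP.
apply: (measurable_case (F := fun i (x : 'rV[R]_d) => sqn (x - c i))) => // i.
rewrite (_ : (fun x : 'rV[R]_d => _) = (fun x : 'rV[R]_d => sqn (c i - x))); last first.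
  by apply/funext => x; exact: sqnB.
by apply: measurable_continuous; exact: continuous_sqnB.
Qed.

(** Dominated convergence: pointwise convergence comes from density, and the bound [sqn x] from the
    presence of the origin among the candidates. *)
Let near_cvg : (\int[mu]_x (sqn (x - a (near n x)))%:E @[n --> \oo] --> 0%:E)%E.
Proof.
have [|||||_ _] := @dominated_convergence _ _ R mu setT measurableT
  (fun n x => (sqn (x - a (near n x)))%:E) (cst 0%E) (fun x => (sqn x)%:E).
- by move=> n; exact: (measurable_fun_cost (fun i : 'I_n.+1 => a i) (@mnear n)).
- exact: measurable_cst.
- apply: aeW => x _; apply/fine_cvgP; split; first exact: nearW.
  apply/cvgrPdist_lt => e e0; have [k kP] := a_dense x e0.
  exists k => // n /= kn; rewrite sub0r normrN ger0_norm ?sqn_ge0//.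
  exact: le_lt_trans (nearP _ kn) kP.
- exact: integrable_sqn.
- apply: aeW => x n _; rewrite gee0_abs lee_fin ?sqn_ge0//.
  by have := @nearP n x 0%N (leq0n n); rewrite subr0.
by rewrite integral0.
Qed.

(** The cells of [near n] have small cost but may be null, and later steps divide by their masses.
    The index set is restricted to the cells of positive mass; the exceptional points form a null
    set [N] and are sent to the arbitrary cell [j0], which alters neither masses nor cost. *)
Lemma fine_partition (e : R) : 0 < e ->
  exists (I : finType) (s : 'rV[R]_d -> I) (p : I -> R) (c : I -> 'rV[R]_d),
  [/\ forall i, measurable (s @^-1` [set i]), forall i, 0 < p i,
      forall i, mu (s @^-1` [set i]) = (p i)%:E &
      (\int[mu]_x (sqn (x - c (s x)))%:E <= e%:E)%E].
Proof.
move=> e0; have /fine_cvgP[] := near_cvg.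
move=> [N1 _ hN1] /cvgrPdist_lt/(_ _ e0)[N2 _ hN2].
pose n := maxn N1 N2.
have {hN1 hN2} near_le : (\int[mu]_x (sqn (x - a (near n x)))%:E <= e%:E)%E.
  have h1 := hN1 n (leq_maxl _ _); have /= := hN2 n (leq_maxr _ _).
  rewrite sub0r normrN => /(le_lt_trans (ler_norm _)) /ltW.
  by rewrite -lee_fin fineK.
pose p i := fine (mu (near n @^-1` [set i])).
have pE i : mu (near n @^-1` [set i]) = (p i)%:E.
  by rewrite fineK//; exact: fin_num_measure.
have p_ge0 i : 0 <= p i by rewrite fine_ge0.
have [i0 pi0] : exists i, 0 < p i.
  apply/not_existsP => h.
  have := integral_cells (@mnear n) pE (fun _ => 1).
  rewrite integral_cst_prob big1 => [/eqP|i _]; first by rewrite eqe oner_eq0.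
  by rewrite mulr1; apply/eqP; rewrite eq_le p_ge0 andbT leNgt; apply/negP/h.
pose I : finType := {i : 'I_n.+1 | 0 < p i}.
pose j0 : I := exist _ i0 pi0.
pose g i : I := insubd j0 i.
pose N := [set x | ~~ (0 < p (near n x))].
have mN : measurable N.
  have -> : N = \bigcup_(i in [set i | ~~ (0 < p i)]) (near n @^-1` [set i]).
    by apply/seteqP; split => [x /= Nx|x [i /= hi nx]]; [exists (near n x)|rewrite /N/= nx].
  by apply: fin_bigcup_measurable => // i _; exact: mnear.
have muN : mu N = 0%E.
  have := integral_cells (@mnear n) pE (fun i => (~~ (0 < p i))%:R).
  rewrite big1 => [|i _]; last first.
    case: (boolP (0 < p i)) => [_|]; first by rewrite mulr0.
    by rewrite -leNgt mulr1 => pi; apply/eqP; rewrite eq_le pi p_ge0.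
  move=> intN; transitivity (\int[mu]_x ((~~ (0 < p (near n x)))%:R : R)%:E)%E => //.
  rewrite -[in LHS](setIT N) -integral_indic//.
  apply: eq_integral => x _; rewrite indicE.
  suff -> : (x \in N) = ~~ (0 < p (near n x)) by [].
  by apply/idP/idP => [/set_mem //|h]; exact: mem_set.
pose v (i : I) : 'I_n.+1 := val i.
exists I, (g \o near n), (fun i => p (v i)), (fun i => a (v i)).
have mgn i : measurable ((g \o near n) @^-1` [set i]).
  have -> : (g \o near n) @^-1` [set i] = \bigcup_(j in [set j | g j = i]) (near n @^-1` [set j]).
    by apply/seteqP; split => [x /= Nx|x [j /= hi nx]]; [exists (near n x)|rewrite /= nx].
  by apply: fin_bigcup_measurable => // j _; exact: mnear.
have gN x : ~ N x -> v (g (near n x)) = near n x.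
  by move=> /negP; rewrite negbK => h; rewrite /g /v insubdK.
split => //.
- by case.
- move=> i; rewrite -pE; apply/eqP; rewrite eq_le; apply/andP; split.
  + apply: (@le_trans _ _ (mu ((near n @^-1` [set v i]) `|` N))).
      apply: le_measure; rewrite ?inE//; first exact: measurableU.
      move=> x /= <-; have [Nx|/gN nN] := pselect (N x); first by right.
      by left.
    by rewrite (le_trans (measureU2 _ _ _))// [X in (_ + X)%E]muN adde0.
  + apply: le_measure; rewrite ?inE// => x /= xi; apply: val_inj.
    rewrite -[LHS]/(v _) gN ?xi// /N/= xi.
    by apply/negP; rewrite negbK; case: (i).
- rewrite (_ : (\int[mu]_x _ = \int[mu]_x (sqn (x - a (near n x)))%:E)%E)//.
  apply: ae_eq_integral => //.
  + exact: (measurable_fun_cost (fun i : I => a (v i)) mgn).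
  + exact: (measurable_fun_cost (fun i : 'I_n.+1 => a i) (@mnear n)).
  + exists N; split => // x /= h; apply: contrapT => Nx; apply: h => _.
    by rewrite gN.
Qed.

End Partition.

Lemma EFin_Rintegral dT (T : measurableType dT) (R : realType)
    (m : {measure set T -> \bar R}) (f : T -> R) :
  m.-integrable setT (EFin \o f) -> (\int[m]_x (f x)%:E = (\int[m]_x f x)%R%:E)%E.
Proof. by move=> intf; rewrite /Rintegral fineK//; exact: integrable_fin_num. Qed.

Lemma sum_select (R : pzSemiRingType) (I : finType) (k : I) (F : I -> R) :
  \sum_i F i * (k == i)%:R = F k.
Proof.
rewrite (bigD1 k)//= eqxx mulr1 big1 ?addr0// => i.
by rewrite eq_sym => /negbTE ->; rewrite mulr0.
Qed.

Lemma sqn_translate (R : realType) (d : nat) (x a c : 'rV[R]_d) :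
  sqn (x - c) = sqn (x - a) + 2 * dot (a - c) (x - a) + sqn (a - c).
Proof.
rewrite /dot /sqn mulr_sumr -!big_split; apply: eq_bigr => j _.
by rewrite !mxE /=; ring.
Qed.

(** Expansion of $|z + (y - x)|^2 \ge 0$; it bounds from below the infimal convolution of twice an
    affine function of slope [z]. *)
Lemma dot_sqn_ge (R : realType) (d : nat) (x y z : 'rV[R]_d) :
  - sqn z <= 2 * dot z (y - x) + sqn (x - y).
Proof.
rewrite -subr_ge0 /dot /sqn mulr_sumr -sumrN -!big_split -sumrN -big_split /=.
apply: sumr_ge0 => j _; rewrite !mxE.
have := sqr_ge0 (z ord0 j + (y ord0 j - x ord0 j)); nra.
Qed.

(** * Mass and first moments as one vector *)

Section Moments.
Context {R : realType} {d : nat}.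
Implicit Types (m : probability 'rV[R]_d R) (x y z : 'rV[R]_d).

(** Index 0 is the constant 1 and index [lift ord0 j] the coordinate [j], so that an affine function
    is a linear form in the features and its integral against a piece is a pairing with the [d.+1]
    moments of that piece. *)
Definition feature (o : 'I_d.+1) y : R :=
  if unlift ord0 o is Some j then y ord0 j else 1.

Lemma feature0 y : feature ord0 y = 1.
Proof. by rewrite /feature unlift_none. Qed.

Lemma feature_lift j y : feature (lift ord0 j) y = y ord0 j.
Proof. by rewrite /feature liftK. Qed.

Lemma integrable_feature m o : P2 m -> m.-integrable setT (EFin \o feature o).
Proof.
move=> m2; rewrite /feature; case: unlift => [j|].
- exact: integrable_coord.
- exact: finite_measure_integrable_cst.
Qed.

Definition affine (k : 'I_d.+1 -> R) y := \sum_o k o * feature o y.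

Definition slope (k : 'I_d.+1 -> R) : 'rV[R]_d := \row_j k (lift ord0 j).

Lemma affineE k y : affine k y = k ord0 + dot (slope k) y.
Proof.
rewrite /affine big_ord_recl feature0 mulr1; congr (_ + _).
by apply: eq_bigr => j _; rewrite feature_lift mxE.
Qed.

Lemma measurable_affine_fun k : measurable_fun setT (affine k).
Proof.
rewrite (_ : affine k = (fun y => k ord0 + dot (slope k) (y - 0))).
  exact: measurable_affine.
by apply/funext => y; rewrite affineE subr0.
Qed.

Definition moment m (q : 'rV[R]_d -> R) (o : 'I_d.+1) : R :=
  (\int[m]_y (feature o y * q y))%R.

Lemma moment0 m q : moment m q ord0 = (\int[m]_y q y)%R.
Proof. by apply: eq_Rintegral => y _; rewrite feature0 mul1r. Qed.

Lemma moment_lift m q j : moment m q (lift ord0 j) = (\int[m]_y (y ord0 j * q y))%R.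
Proof. by apply: eq_Rintegral => y _; rewrite feature_lift. Qed.

Section Linear.
Variables (m : probability 'rV[R]_d R) (m2 : P2 m).
Variables (I : finType) (q : I -> 'rV[R]_d -> R) (wq : forall i, weight (q i)).
Variable k : I -> 'I_d.+1 -> R.

Let term i o y := k i o * (feature o y * q i y).

Let iterm i o : m.-integrable setT (EFin \o term i o).
Proof.
have := integrableZl measurableT (k i o)
  (integrable_weight (wq i) (integrable_feature o m2)).
by apply: eq_integrable.
Qed.

Let affE y : ((\sum_i affine (k i) y * q i y)%:E = \sum_i \sum_o (term i o y)%:E)%E.
Proof.
rewrite -sumEFin; apply: eq_bigr => i _; rewrite /affine mulr_suml -sumEFin.
by apply: eq_bigr => o _; rewrite /term mulrA.
Qed.

Let isum i : m.-integrable setT (fun y => \sum_o (term i o y)%:E)%E.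
Proof. by apply: integrable_sum => // o _; exact: iterm. Qed.

Lemma integrable_affine_sum :
  m.-integrable setT (EFin \o (fun y => \sum_i affine (k i) y * q i y)).
Proof.
rewrite (_ : EFin \o _ = (fun y => \sum_i \sum_o (term i o y)%:E)%E).
  by apply: integrable_sum => // i _; exact: isum.
by apply/funext => y; exact: affE.
Qed.

Lemma integral_affine_sum : (\int[m]_y (\sum_i affine (k i) y * q i y)%:E =
  (\sum_i \sum_o k i o * moment m (q i) o)%:E)%E.
Proof.
under eq_integral do rewrite affE.
rewrite integral_sum// -sumEFin; apply: eq_bigr => i _.
rewrite integral_sum//; last by move=> o; exact: iterm.
rewrite -sumEFin; apply: eq_bigr => o _; rewrite EFin_Rintegral; last exact: iterm.
rewrite RintegralZl//; exact: (integrable_weight (wq i) (integrable_feature o m2)).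
Qed.

End Linear.

Lemma weight_select (I : finType) (s : 'rV[R]_d -> I) :
  (forall i, measurable (s @^-1` [set i])) ->
  forall i, weight (fun y => (s y == i)%:R : R).
Proof.
move=> ms i; split; last by move=> y; case: (s y == i); rewrite ?ler01 lexx ?ler01.
by apply: (measurable_case (F := fun k (_ : 'rV[R]_d) => (k == i)%:R : R)).
Qed.

End Moments.

(** * Discretized cost and the dual value of a maximum of affine functions *)

Section DiscreteDual.
Context {R : realType} {d : nat} (mu nu : probability 'rV[R]_d R).
Hypotheses (mu2 : P2 mu) (nu2 : P2 nu).
Variables (I : finType) (s : 'rV[R]_d -> I) (p : I -> R).
Hypotheses (ms : forall i, measurable (s @^-1` [set i])) (p0 : forall i, 0 < p i)
  (pmu : forall i, mu (s @^-1` [set i]) = (p i)%:E).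

Definition cell i (x : 'rV[R]_d) : R := (s x == i)%:R.

Let mom i o := moment mu (cell i) o.

Let wcell : forall i, weight (cell i) := weight_select ms.

Lemma cell_moment0 i : moment mu (cell i) ord0 = p i.
Proof.
rewrite moment0; apply: EFin_inj; rewrite -EFin_Rintegral.
  rewrite (integral_cells ms pmu (fun k => (k == i)%:R)); congr (_%:E).
  under eq_bigr do rewrite eq_sym.
  exact: sum_select.
exact: integrable_weight1.
Qed.

Definition cell_mean i : 'rV[R]_d := \row_j (mom i (lift ord0 j) / p i).

Definition bary (q : 'rV[R]_d -> R) i : 'rV[R]_d :=
  \row_j (moment nu q (lift ord0 j) / p i).

(** Bias-variance decomposition: [V] is the total variance within the cells and does not depend on
    [c]. *)
Lemma integral_sqn_cells : exists V : R, forall c : I -> 'rV[R]_d,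
  (\int[mu]_x (sqn (x - c (s x)))%:E =
   (V + \sum_i p i * sqn (cell_mean i - c i))%:E)%E.
Proof.
have isq : mu.-integrable setT (EFin \o (fun x => sqn (x - cell_mean (s x)))).
  have i1 := integrableZl measurableT 2 (integrable_sqn mu2).
  have i2 := integrableZl measurableT 2
    (integrable_cells mu2 ms (fun i => sqn (cell_mean i))).
  apply: (le_integrable measurableT _ _ (integrableD measurableT i1 i2)).
    exact: measurable_fun_cost.
  move=> x _; rewrite /= lee_fin !ger0_norm ?sqn_ge0//.
    exact: sqnB_le.
  by rewrite addr_ge0// mulr_ge0// sqn_ge0.
exists (\int[mu]_x sqn (x - cell_mean (s x)))%R => c.
pose g i := cell_mean i - c i.
(* Coefficients of the cross term $2(m_i - c_i)\cdot(x - m_i)$, whose integral over cell $i$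
   vanishes because $m_i$ is the mean. *)
pose k i o := 2 * (if unlift ord0 o is Some j then g i ord0 j else - dot (g i) (cell_mean i)).
have kE i x : affine (k i) x = 2 * dot (g i) (x - cell_mean i).
  rewrite affineE /k unlift_none dotDr dotNr mulrDr addrC; congr (_ + _).
  rewrite /dot mulr_sumr; apply: eq_bigr => j _.
  by rewrite mxE liftK mulrA.
have sE x : sqn (x - c (s x)) = sqn (x - cell_mean (s x)) +
    \sum_i affine (k i) x * cell i x + sqn (g (s x)).
  by rewrite /cell (sum_select (s x) (fun i => affine (k i) x)) kE -sqn_translate.
have ik := integrable_affine_sum mu2 wcell k.
have ig := integrable_cells mu2 ms (fun i => sqn (g i)).
have -> : (\int[mu]_x (sqn (x - c (s x)))%:E =
  \int[mu]_x ((sqn (x - cell_mean (s x)))%:E + (\sum_i affine (k i) x * cell i x)%:E +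
    (sqn (g (s x)))%:E))%E.
  by apply: eq_integral => x _; rewrite sE !EFinD.
rewrite integralD//; last exact: (integrableD measurableT isq ik).
rewrite integralD// (integral_cells ms pmu (fun i => sqn (g i))).
rewrite integral_affine_sum// EFin_Rintegral// -!EFinD; congr (_%:E).
rewrite [X in _ + X + _]big1 ?addr0// => i _.
rewrite big_ord_recl -/(mom _ _) [mom i ord0]cell_moment0 {1}/k unlift_none.
rewrite [X in _ + X](_ : _ = 2 * \sum_j g i ord0 j * mom i (lift ord0 j)); last first.
  by rewrite mulr_sumr; apply: eq_bigr => j _; rewrite /k liftK mulrA.
rewrite -mulrA -mulrDr mulNr addrC /dot mulr_suml -sumrB big1 ?mulr0// => j _.
by rewrite !mxE -mulrA divfK ?gt_eqF// subrr.
Qed.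

(** Tests [D2_down] with twice the maximum [lam] of the affine functions, [S] selecting an active
    one. At [x] the convolution is bounded below by keeping only the affine function of the cell of
    [x], which lies below [lam]. *)
Lemma dual_value_ge (k : I -> 'I_d.+1 -> R) (S : 'rV[R]_d -> I) :
  (forall i, measurable (S @^-1` [set i])) ->
  (forall i y, affine (k i) y <= affine (k (S y)) y) ->
  ((2 * (\sum_i \sum_o k i o * mom i o) - \sum_i p i * sqn (slope (k i)) -
    2 * \sum_i \sum_o k i o * moment nu (fun y => (S y == i)%:R) o)%:E <=
   D2_down mu nu)%E.
Proof.
move=> mS kS; pose lam y := affine (k (S y)) y.
have lamE y : lam y = \sum_i affine (k i) y * (S y == i)%:R.
  by rewrite (sum_select (S y) (fun i => affine (k i) y)).
have clam : conv_fun (fun y => 2 * lam y).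
  (* The function active at the combined point is affine and lies below [lam] at both endpoints. *)
  move=> x y t t0 t1; rewrite /lam; set i := S (_ + _).
  have := kS i x; have := kS i y.
  rewrite (affineE _ (_ + _)) dotDr !dotZr => h1 h2.
  have : t * affine (k i) x <= t * affine (k (S x)) x by rewrite ler_pM2l.
  have : (1 - t) * affine (k i) y <= (1 - t) * affine (k (S y)) y.
    by rewrite ler_pM2l// subr_gt0.
  rewrite !(affineE (k i)); lra.
have wS := weight_select mS.
have ilam : nu.-integrable setT (EFin \o lam).
  rewrite (_ : EFin \o lam = EFin \o (fun y => \sum_i affine (k i) y * (S y == i)%:R)).
    exact: integrable_affine_sum.
  by apply/funext => y /=; rewrite lamE.
have i2lam : nu.-integrable setT (EFin \o (fun y => 2 * lam y)).
  by have := integrableZl measurableT 2 ilam; apply: eq_integrable.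
have Alam := conv_fun_Acx clam.
apply: le_trans (D2_down_ub mu Alam i2lam).
have -> : (\int[nu]_y ((EFin \o (fun y => 2 * lam y)%R) y) =
   (2 * \sum_i \sum_o k i o * moment nu (fun y => (S y == i)%:R) o)%:E)%E.
  rewrite EFin_Rintegral// RintegralZl// EFinM [RHS]EFinM; congr (_ * _)%E.
  rewrite -EFin_Rintegral// -integral_affine_sum//.
  by apply: eq_integral => y _; rewrite lamE.
rewrite EFinB; apply: leeB => //.
pose G x := 2 * affine (k (s x)) x - sqn (slope (k (s x))).
have ia := integrable_affine_sum mu2 wcell k.
have isl := integrable_cells mu2 ms (fun i => sqn (slope (k i))).
have aE x : \sum_i affine (k i) x * cell i x = affine (k (s x)) x.
  by rewrite /cell (sum_select (s x) (fun i => affine (k i) x)).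
have iG : mu.-integrable setT (EFin \o G).
  have := integrableB measurableT (integrableZl measurableT 2 ia) isl.
  by apply: eq_integrable => // x _ /=; rewrite aE.
have -> : ((2 * (\sum_i \sum_o k i o * mom i o) - \sum_i p i * sqn (slope (k i)))%:E =
   \int[mu]_x (G x)%:E)%E.
  have -> : (\int[mu]_x (G x)%:E = \int[mu]_x (2%:E * (\sum_i affine (k i) x * cell i x)%:E -
     (sqn (slope (k (s x))))%:E))%E.
    by apply: eq_integral => x _; rewrite aE.
  rewrite integralB//; last exact: integrableZl.
  by rewrite integralZl// integral_affine_sum// (integral_cells ms pmu (fun i => sqn (slope (k i)))).
apply: le_integral => //.
  by apply: integrable_Sb2 => //; exact: Q2_Sb2.
move=> x _; apply: le_ereal_inf_tmp => _ [y _ <-] /=.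
rewrite -EFinD lee_fin /G.
have := kS (s x) y; rewrite -/(lam y) !affineE; set z := slope _ => h.
have : - sqn z <= 2 * dot z (y - x) + sqn (x - y).
  exact: dot_sqn_ge.
rewrite dotDr dotNr; lra.
Qed.

End DiscreteDual.

(** * Strong duality *)

Section SplitUnity.
Context {R : realType} {d : nat} (nu : probability 'rV[R]_d R) (nu2 : P2 nu).

Lemma integrable_moment (q : 'rV[R]_d -> R) o : weight q ->
  nu.-integrable setT (EFin \o (fun y => feature o y * q y)).
Proof. by move=> wq; apply: integrable_weight => //; exact: integrable_feature. Qed.

Lemma moment_linear (q q' : 'rV[R]_d -> R) (a b : R) o : weight q -> weight q' ->
  moment nu (fun y => a * q y + b * q' y) o = a * moment nu q o + b * moment nu q' o.
Proof.
move=> wq wq'; rewrite /moment -!RintegralZl//; [|exact: integrable_moment..].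
rewrite -RintegralD//; first by apply: eq_Rintegral => y _; ring.
- by have := integrableZl measurableT a (integrable_moment o wq); apply: eq_integrable.
- by have := integrableZl measurableT b (integrable_moment o wq'); apply: eq_integrable.
Qed.

Variable I : finType.

Definition split_unity (q : I -> 'rV[R]_d -> R) :=
  (forall i, weight (q i)) /\ (forall y, \sum_i q i y = 1).

Lemma split_select (S : 'rV[R]_d -> I) : (forall i, measurable (S @^-1` [set i])) ->
  split_unity (fun i y => (S y == i)%:R).
Proof.
move=> mS; split; first exact: weight_select.
move=> y; rewrite -[RHS](sum_select (S y) (fun=> 1 : R)).
by apply: eq_bigr => i _; rewrite mul1r.
Qed.

Lemma split_mix q q' t : split_unity q -> split_unity q' -> 0 <= t -> t <= 1 ->
  split_unity (fun i y => (1 - t) * q i y + t * q' i y).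
Proof.
move=> [wq q1] [wq' q1'] t0 t1; split => [i|y]; last first.
  by rewrite big_split/= -!mulr_sumr q1 q1'; ring.
have [mq qb] := wq i; have [mq' qb'] := wq' i; split.
  by apply: measurable_funD; apply: measurable_funM.
move=> y; have /andP[h1 h2] := qb y; have /andP[h3 h4] := qb' y.
by apply/andP; split; nra.
Qed.

Lemma split_mass q : split_unity q -> \sum_i moment nu (q i) ord0 = 1.
Proof.
move=> [wq q1]; apply: EFin_inj; rewrite -sumEFin.
under eq_bigr do rewrite moment0 -EFin_Rintegral ?integrable_weight1//.
rewrite -integral_sum//; last by move=> i; exact: integrable_weight1.
rewrite -[RHS](integral_cst_prob nu); apply: eq_integral => y _.
by rewrite sumEFin q1.
Qed.

End SplitUnity.

Section StrongDuality.
Context {R : realType} {d : nat} (mu nu : probability 'rV[R]_d R).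
Hypotheses (mu2 : P2 mu) (nu2 : P2 nu).

Section FixedPartition.
Variables (I : finType) (s : 'rV[R]_d -> I) (p : I -> R).
Hypotheses (ms : forall i, measurable (s @^-1` [set i])) (p0 : forall i, 0 < p i)
  (pmu : forall i, mu (s @^-1` [set i]) = (p i)%:E).

Let mom i o := moment mu (cell s i) o.

Let fD := fine (D2_down mu nu).

(** With $Z = \sum_i p_i|m_i - b_i|^2$ and [k] the weighted difference of moments, the pairing of
    [k] with that difference is the mass penalty plus $Z$, while $\sum_i p_i|slope|^2 = Z$. The dual
    value, which doubles the pairing and subtracts the slope term, is thus at least twice the
    penalty plus $Z$, up to the doubled projection error $2e$. *)
Lemma near_optimal (K e : R) : 0 <= K -> 0 < e ->
  exists2 q, split_unity q &
    2 * K * (\sum_i (p i - moment nu (q i) ord0) ^+ 2) +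
    \sum_i p i * sqn (cell_mean mu s p i - bary nu p (q i) i) <= fD + 2 * e.
Proof.
move=> K0 e0.
pose J : finType := (I * 'I_d.+1)%type.
pose w (j : J) : R := if unlift ord0 j.2 is Some _ then (p j.1)^-1 else K.
pose a (j : J) := mom j.1 j.2.
pose B := [set v : J -> R | exists2 q, split_unity q &
  forall j, v j = moment nu (q j.1) j.2].
(* Summing over all features gives one bound valid for every component [j]. *)
pose bd := \sum_(o < d.+1) (\int[nu]_y `|feature o y|)%R.
have w0 j : 0 <= w j.
  by rewrite /w; case: unlift => // _; rewrite invr_ge0 ltW.
have B0 : B !=set0.
  have mc i : measurable ((fun _ : 'rV[R]_d => s 0) @^-1` [set i]).
    have -> : (fun _ : 'rV[R]_d => s 0) @^-1` [set i] = if s 0 == i then setT else set0.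
      by case: eqP => h; apply/seteqP; split.
    by case: ifP.
  exists (fun j : J => moment nu (fun y => (s 0 == j.1)%:R) j.2).
  by exists (fun i y => (s 0 == i)%:R) => //; exact: (split_select mc).
have cB u v t : B u -> B v -> 0 <= t -> t <= 1 -> B (fun j => (1 - t) * u j + t * v j).
  move=> [q sq uq] [q' sq' vq] t0 t1.
  exists (fun i y => (1 - t) * q i y + t * q' i y); first exact: split_mix.
  by move=> j; rewrite moment_linear ?uq ?vq//; [case: sq|case: sq'].
have bB v j : B v -> `|v j| <= bd.
  move=> [q [wq q1] ->]; have iq := integrable_moment nu2 j.2 (wq j.1).
  have ifn := integrable_feature j.2 nu2.
  have ina : nu.-integrable setT (EFin \o (fun y => `|feature j.2 y|)).
    by have := integrable_norm ifn.
  rewrite /bd (bigD1 j.2)//= (le_trans (le_normr_Rintegral measurableT iq))//.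
  apply: (@le_trans _ _ (\int[nu]_y `|feature j.2 y|)%R); last first.
    rewrite lerDl; apply: sumr_ge0 => o _; apply: Rintegral_ge0 => y _; exact: normr_ge0.
  apply: le_Rintegral => //; first by have := integrable_norm iq.
  move=> y _; rewrite normrM; have [_ /(_ y)/andP[h1 h2]] := wq j.1.
  by rewrite [X in _ * X]ger0_norm// -[leRHS]mulr1 ler_wpM2l.
have [u [q sq uq] uP] := approx_projection a w0 B0 cB bB e0.
exists q => //.
pose k i o := w (i, o) * (mom i o - moment nu (q i) o).
pose S := argmax_sel (s 0) (fun i y => affine (k i) y).
have mS i : measurable (S @^-1` [set i]).
  by apply: measurable_argmax_sel => j; exact: measurable_affine_fun.
have SP i y : affine (k i) y <= affine (k (S y)) y.
  exact: (@argmax_selP _ 'rV[R]_d R I (s 0) (fun i y => affine (k i) y) y i).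
have := dual_value_ge mu2 nu2 ms pmu mS SP.
rewrite -(fineK (D2_down_fin_num mu2 nu2)) lee_fin -/fD.
(* The split induced by the maximizing selector is the competitor in the variational inequality,
   since its pairing with [k] is the integral of [lam] that the dual value subtracts. *)
have vB : B (fun j => moment nu (fun y => (S y == j.1)%:R) j.2).
  by exists (fun i y => (S y == i)%:R) => //; exact: split_select.
have := uP _ vB.
rewrite (eq_bigr (fun j : J => k j.1 j.2 * (moment nu (fun y => (S y == j.1)%:R) j.2 -
   moment nu (q j.1) j.2))); last by move=> [i o] _; rewrite !uq.
rewrite -(pair_bigA _ (fun i o => k i o * (moment nu (fun y => (S y == i)%:R) o -
   moment nu (q i) o)))/=.
set A := \sum_i \sum_o k i o * moment nu (fun y => (S y == i)%:R) o.
set Bq := \sum_i \sum_o k i o * moment nu (q i) o.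
set M := \sum_i \sum_o k i o * moment mu _ o.
have -> : \sum_i \sum_o k i o * (moment nu (fun y => (S y == i)%:R) o -
   moment nu (q i) o) = A - Bq.
  rewrite /A /Bq -sumrB; apply: eq_bigr => i _; rewrite -sumrB.
  by apply: eq_bigr => o _; rewrite mulrBr.
pose Z := \sum_i p i * sqn (cell_mean mu s p i - bary nu p (q i) i).
have slopeE i : slope (k i) = cell_mean mu s p i - bary nu p (q i) i.
  by apply/rowP => j; rewrite !mxE /k /w liftK/= -mulrBl mulrC.
have -> : \sum_i p i * sqn (slope (k i)) = Z.
  by apply: eq_bigr => i _; rewrite slopeE.
have MB : M - Bq = K * (\sum_i (p i - moment nu (q i) ord0) ^+ 2) + Z.
  rewrite /M /Bq /Z -sumrB mulr_sumr -big_split; apply: eq_bigr => i _ /=.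
  rewrite -sumrB big_ord_recl; congr (_ + _).
    by rewrite -mulrBr /k /w/= unlift_none /mom (cell_moment0 ms pmu) expr2 mulrA.
  rewrite /sqn mulr_sumr; apply: eq_bigr => j _.
  rewrite -mulrBr -slopeE mxE {1}/k /w liftK /= /k /w liftK /=.
  set x := _ - _.
  by field; rewrite gt_eqF.
rewrite -/Z -/M; move=> h1 h2; lra.
Qed.

End FixedPartition.

(* The masses of the near-optimal split are only approximately right; adding
   constants to a slightly shrunk split corrects them exactly. *)
Lemma strong_duality (e : R) : 0 < e ->
  (T2_up mu nu <= D2_down mu nu + e%:E)%E /\ (T2_down mu nu <= D2_down mu nu + e%:E)%E.
Proof.
(* Four shares of the error: the within-cell variance [V], twice the projection tolerance, and the
   mass correction [t * C]. *)
move=> e0'; pose e' := e / 4; have e0 : 0 < e' by rewrite divr_gt0.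
have [I [s [p [c [ms p0 pmu hc]]]]] := fine_partition mu2 e0.
have [V hV] := integral_sqn_cells mu2 ms p0 pmu.
pose mb := cell_mean mu s p.
have pS i (v : 'rV[R]_d) : 0 <= p i * sqn v by rewrite mulr_ge0 ?sqn_ge0// ltW.
(* [V] is the cost with the cell means, hence at most the cost with the centers [c] of the
   partition. *)
have Ve : V <= e'.
  move: hc; rewrite hV lee_fin; apply: le_trans.
  by rewrite lerDl; apply: sumr_ge0 => i _; exact: pS.
have w1 : weight (fun _ : 'rV[R]_d => 1 : R).
  by split=> [|y]; [exact: measurable_cst|rewrite ler01 lexx].
pose yb : 'rV[R]_d := \row_j moment nu (fun _ => 1) (lift ord0 j).
(* Bounds the effect of the correction: [2 * sqn (mb i) + 2 * sqn (ci *: yb)] with [ci <= 2] below,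
   whence the 8. *)
pose C := \sum_i p i * (2 * sqn (mb i) + 8 * sqn yb).
have C0 : 0 <= C.
  apply: sumr_ge0 => i _; rewrite mulr_ge0 ?(ltW (p0 i))//.
  by rewrite addr_ge0// mulr_ge0// sqn_ge0.
pose t := Num.min 1 (e' / (C + 1)).
have C1 : 0 < C + 1 by lra.
have t0 : 0 < t by rewrite lt_min ltr01 divr_gt0.
have t1 : t <= 1 by rewrite ge_min lexx.
have tC : t * C <= e'.
  have : t * (C + 1) <= e' by rewrite -ler_pdivlMr// ge_min lexx orbT.
  nra.
pose fD := fine (D2_down mu nu).
pose A := `|fD| + 2 * e'.
have A0 : 0 < A by rewrite ltr_wpDl// mulr_gt0.
have fDA : fD + 2 * e' <= A by rewrite lerD2r ler_norm.
have tp i : 0 < (t * p i) ^+ 2 by rewrite exprn_gt0// mulr_gt0.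
(* [A] bounds the penalized total, and [K] dominates every [A / (t * p i) ^+ 2]; each mass error is
   therefore at most [t * p i]. *)
pose K := A * \sum_i ((t * p i) ^+ 2)^-1.
have K0 : 0 <= K.
  by rewrite mulr_ge0 ?(ltW A0)// sumr_ge0// => i _; rewrite invr_ge0 ltW.
have [q sq] := near_optimal ms p0 pmu K0 e0.
have [wq q1] := sq.
set Z := \sum_i _ * sqn _; rewrite -/fD => hq.
have Z0 : 0 <= Z by apply: sumr_ge0 => i _; exact: pS.
pose M i := moment nu (q i) ord0.
have Mp i : `|p i - M i| <= t * p i.
  rewrite -ler_sqr ?nnegrE ?mulr_ge0 ?(ltW t0) ?(ltW (p0 i))//.
  rewrite real_normK ?num_real//.
  have h1 : 2 * K * (p i - M i) ^+ 2 <= A.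
    apply: le_trans fDA; apply: le_trans hq; rewrite -[leLHS]addr0 lerD//.
    apply: ler_wpM2l; first by rewrite mulr_ge0.
    by rewrite (bigD1 i)//= lerDl; apply: sumr_ge0 => j _; exact: sqr_ge0.
  have h2 : A * ((t * p i) ^+ 2)^-1 <= K.
    rewrite ler_pM2l// (bigD1 i)//= lerDl.
    by apply: sumr_ge0 => j _; rewrite invr_ge0 ltW.
  have h3 : A * ((t * p i) ^+ 2)^-1 * (p i - M i) ^+ 2 <= A.
    apply: le_trans h1; apply: ler_wpM2r; first exact: sqr_ge0.
    by lra.
  move: h3; rewrite -mulrA -[leRHS]mulr1 ler_pM2l// mulrC.
  by rewrite ler_pdivrMr// mul1r.
(* The mass missing from the piece shrunk by [1 - t]. The shrinking is what makes it nonnegative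
   even when [M i] exceeds [p i], by at most [t * p i]. *)
pose k i := p i - (1 - t) * M i.
have kP i : 0 <= k i <= 2 * t * p i.
  have := Mp i; have := p0 i; rewrite ler_norml /k => h1 /andP[h2 h3].
  by apply/andP; split; nra.
pose q' i y := (1 - t) * q i y + k i * 1.
have t1' : 0 <= 1 - t by rewrite subr_ge0.
have q'1 y : \sum_i q' i y = 1.
  rewrite big_split/= -mulr_sumr q1; under eq_bigr do rewrite mulr1.
  rewrite sumrB -mulr_sumr (split_mass nu sq).
  have -> : \sum_i p i = 1.
    apply: EFin_inj; rewrite -[RHS](integral_cst_prob mu).
    rewrite (integral_cells ms pmu (fun=> 1)); congr (_%:E).
    by apply: eq_bigr => i _; rewrite mulr1.
  by ring.
have q'0 i y : 0 <= q' i y.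
  have [_ /(_ y)/andP[h1 _]] := wq i; have /andP[h2 _] := kP i.
  by rewrite addr_ge0// mulr_ge0.
have wq' i : weight (q' i).
  split.
    have [mq _] := wq i.
    by apply: measurable_funD; [exact: measurable_funM|exact: measurable_cst].
  move=> y; rewrite q'0/= -(q'1 y) (bigD1 i)//= lerDl.
  by apply: sumr_ge0 => j _; exact: q'0.
have q'M i o : moment nu (q' i) o = (1 - t) * moment nu (q i) o + k i * moment nu (fun _ => 1) o.
  exact: moment_linear.
have pq' i : (\int[nu]_y q' i y)%R = p i.
  rewrite -moment0 q'M -/(M i) [moment _ (fun _ => 1) _]moment0.
  have -> : (\int[nu]_y (1 : R))%R = 1.
    by rewrite /Rintegral integral_cst_prob.
  by rewrite /k; ring.
pose b i := bary nu p (q' i) i.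
have bE i j : (\int[nu]_y (y ord0 j * q' i y))%R = p i * b i ord0 j.
  by rewrite mxE mulrC divfK ?gt_eqF// moment_lift.
suff cost : (\int[mu]_x (sqn (x - b (s x)))%:E <= D2_down mu nu + e%:E)%E.
  split; apply: le_trans cost.
  - exact: (T2_up_le mu2 nu2 ms wq' q'1 p0 pmu pq' bE).
  - exact: (T2_down_le mu2 nu2 ms wq' q'1 pmu pq' bE).
rewrite hV -(fineK (D2_down_fin_num mu2 nu2)) -/fD -EFinD lee_fin -/mb.
suff : \sum_i p i * sqn (mb i - b i) <= Z + t * C.
  rewrite /e' in e0 Ve tC hq *.
  have : 0 <= 2 * K * \sum_i (p i - moment nu (q i) ord0) ^+ 2.
    by apply: mulr_ge0; [rewrite mulr_ge0|apply: sumr_ge0 => i _; exact: sqr_ge0].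
  lra.
rewrite /C /Z mulr_sumr -big_split; apply: ler_sum => i _ /=.
have [pi0 pin0] : 0 < p i /\ p i != 0 by rewrite gt_eqF ?p0.
pose ci := k i / (p i * t).
have ci02 : 0 <= ci <= 2.
  have /andP[h1 h2] := kP i; apply/andP; split.
    by rewrite divr_ge0// mulr_ge0// ltW.
  by rewrite ler_pdivrMr ?mulr_gt0// [p i * t]mulrC mulrA.
(* The corrected barycenter is [(1 - t)] times the old one plus [t * ci] times the mean [yb] of
   [nu]; convexity of [sqn] then separates the old cost from an error of order [t]. *)
have -> : mb i - b i = t *: (mb i - ci *: yb) + (1 - t) *: (mb i - bary nu p (q i) i).
  apply/rowP => j; rewrite !mxE q'M /ci; field.
  by rewrite pin0 gt_eqF.
have h1 := sqn_conv (mb i - ci *: yb) (mb i - bary nu p (q i) i) (ltW t0) t1.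
have h2 := sqnB_le (mb i) (ci *: yb).
have h3 : sqn (ci *: yb) <= 4 * sqn yb.
  rewrite /sqn mulr_sumr; apply: ler_sum => j _; rewrite mxE exprMn.
  rewrite ler_wpM2r ?sqr_ge0//.
  by case/andP: ci02 => ? ?; nra.
have h4 : (1 - t) * sqn (mb i - bary nu p (q i) i) <= sqn (mb i - bary nu p (q i) i).
  by have := sqn_ge0 (mb i - bary nu p (q i) i); nra.
have h5 : t * sqn (mb i - ci *: yb) <= t * (2 * sqn (mb i) + 8 * sqn yb).
  by rewrite ler_pM2l//; lra.
rewrite [t * (p i * _)]mulrCA -mulrDr ler_pM2l//; lra.
Qed.

End StrongDuality.

Unset Implicit Arguments.
Set Strict Implicit.
Local Open Scope ereal_scope.

Theorem mainTheorem13 (R : realType) (d : nat) (mu nu : probability 'rV[R]_d R) :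
  P2 mu -> P2 nu ->
  [/\ T2_up mu nu = D2_up mu nu,
      D2_up mu nu = D2_down mu nu,
      D2_down mu nu = T2_down mu nu,
      (forall phif : 'rV[R]_d -> \bar R,
         Acx phif -> Cb2 phif ->
         \int[mu]_x phif x - \int[nu]_x Qbar2 phif x = D2_up mu nu ->
         [/\ Acx (Qbar2 phif), nu.-integrable setT (Qbar2 phif) &
             \int[mu]_x Q2 (Qbar2 phif) x - \int[nu]_x Qbar2 phif x = D2_down mu nu]) &
      (forall phib : 'rV[R]_d -> \bar R,
         Acx phib -> nu.-integrable setT phib ->
         \int[mu]_x Q2 phib x - \int[nu]_x phib x = D2_down mu nu ->
         [/\ Acx (Q2 phib), Sb2 (Q2 phib) &
             \int[mu]_x Q2 phib x - \int[nu]_x Qbar2 (Q2 phib) x = D2_up mu nu])].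
Proof.
move=> mu2 nu2; split.
- apply/eqP; rewrite eq_le D2_up_le_T2_up// andbT D2_up_down//.
  by apply/lee_addgt0Pr => e e0; case: (strong_duality mu2 nu2 e0).
- exact: D2_up_down.
- apply/eqP; rewrite eq_le D2_down_le_T2_down//=.
  by apply/lee_addgt0Pr => e e0; case: (strong_duality mu2 nu2 e0).
- by move=> phif Aphi Cphi; exact: forward_optimizer.
- by move=> phib Aphi iphi; exact: backward_optimizer.
Qed.
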